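(* Let $\mathcal{L}$ be any level (full level $n\in\mathbb{N}_{\geq 0}$ or half level $n+1/2$) of the Straubing–Thérien hierarchy or of the dot-depth hierarchy. Then the $\mathcal{L}$-Membership problem for NFAs (input: an NFA $A$ over an alphabet $\Sigma$; question: does $L(A)$ belong to the level $\mathcal{L}$ taken over $\Sigma$?) is $\mathsf{PSPACE}$-hard, even when restricted to NFAs over a binary alphabet.
   Context: Fix a finite alphabet $\Sigma$. A marked product of languages $L_0,\dots,L_k\subseteq\Sigma^*$ is a language $L_0a_1L_1\cdots a_kL_k$ with letters $a_i\in\Sigma$. The polynomial closure of a class $\mathcal{C}$ of languages is the set of finite unions of marked products of languages from $\mathcal{C}$. The concatenation hierarchy with basis $\mathcal{C}$ is defined by: level $0$ is $\mathcal{C}$; for $n\geq 0$, level $n+1/2$ is the polynomial closure of level $n$, and level $n+1$ is the Boolean closure (finite unions, finite intersections, complements in $\Sigma^*$) of level $n+1/2$. The Straubing–Thérien hierarchy (levels $\mathsf{ST}_n$) is the concatenation hierarchy with basis $\{\emptyset,\Sigma^*\}$; the dot-depth hierarchy (levels $\mathsf{DD}_n$) is the concatenation hierarchy with basis the class of all finite and all cofinite languages over $\Sigma$. NFAs have one initial state and no $\varepsilon$-transitions. Hardness is with respect to deterministic logspace many-one reductions. *)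

(* Defs.v *)
From Stdlib Require List.
From mathcomp Require Import all_boot.
Unset Printing Implicit Defensive.

Definition lang (k : nat) := seq 'I_k -> Prop.
Definition lclass (k : nat) := lang k -> Prop.

(* marked product  L0 a1 L1 ... am Lm, given L0 and [(a1,L1);...;(am,Lm)] *)
Fixpoint mprod {k : nat} (L0 : lang k) (r : seq ('I_k * lang k)) : lang k :=
  match r with
  | [::] => L0
  | (a, L1) :: r' =>
      fun w => exists u v, w = u ++ a :: v /\ L0 u /\ mprod L1 r' v
  end.

Definition Pol {k : nat} (C : lclass k) : lclass k := fun L =>
  exists ps : seq (lang k * seq ('I_k * lang k)),
    (forall p, List.In p ps -> C p.1 /\ forall q, List.In q p.2 -> C q.2) /\
    (forall w, L w <-> exists p, List.In p ps /\ mprod p.1 p.2 w).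

Inductive BoolCl {k : nat} (C : lclass k) : lclass k :=
| bc_base L : C L -> BoolCl C L
| bc_ext L L' : BoolCl C L -> (forall w, L w <-> L' w) -> BoolCl C L'
| bc_empty : BoolCl C (fun _ => False)
| bc_union L1 L2 : BoolCl C L1 -> BoolCl C L2 -> BoolCl C (fun w => L1 w \/ L2 w)
| bc_inter L1 L2 : BoolCl C L1 -> BoolCl C L2 -> BoolCl C (fun w => L1 w /\ L2 w)
| bc_compl L : BoolCl C L -> BoolCl C (fun w => ~ L w).

Fixpoint full_level {k : nat} (C : lclass k) (n : nat) : lclass k :=
  match n with
  | 0 => C
  | n'.+1 => BoolCl (Pol (full_level C n'))
  end.

Definition half_level {k : nat} (C : lclass k) (n : nat) : lclass k :=
  Pol (full_level C n).

Definition ST_basis (k : nat) : lclass k := fun L =>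
  (forall w, L w <-> False) \/ (forall w, L w <-> True).

Definition DD_basis (k : nat) : lclass k := fun L =>
  exists s : seq (seq 'I_k),
    (forall w, L w <-> w \in s) \/ (forall w, L w <-> w \notin s).

Inductive hierarchy := ST | DD.

Definition basis (h : hierarchy) (k : nat) : lclass k :=
  match h with ST => @ST_basis k | DD => @DD_basis k end.

Definition level (h : hierarchy) (n : nat) (half : bool) (k : nat) : lclass k :=
  if half then half_level (@basis h k) n else full_level (@basis h k) n.

(* NFAs: alphabet {0..alph-1}, states {0..nst-1}, one initial state.  *)
Record nfa := NFA {
  alph : nat; nst : nat; init : nat;
  trans : seq (nat * nat * nat);  (* (p, a, q) *)
  fin : seq nat }.

Definition nfa_wf (A : nfa) : bool :=
  [&& init A < nst A,
      all (fun t => [&& t.1.1 < nst A, t.1.2 < alph A & t.2 < nst A]) (trans A)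
    & all (fun q => q < nst A) (fin A)].

Fixpoint acc_from (A : nfa) (p : nat) (w : seq nat) : Prop :=
  match w with
  | [::] => p \in fin A
  | a :: w' => exists q, (p, a, q) \in trans A /\ acc_from A q w'
  end.

Definition nfa_lang (A : nfa) : lang (alph A) :=
  fun w => acc_from A (init A) (map (@nat_of_ord _) w).

(* standard (unary, prefix-free) encoding of an NFA as a bit string *)
Definition enc_nat (n : nat) : seq bool := nseq n true ++ [:: false].
Definition enc_nfa (A : nfa) : seq bool :=
  enc_nat (alph A) ++ enc_nat (nst A) ++ enc_nat (init A) ++
  enc_nat (size (trans A)) ++
  flatten [seq enc_nat t.1.1 ++ enc_nat t.1.2 ++ enc_nat t.2 | t <- trans A] ++
  enc_nat (size (fin A)) ++ flatten [seq enc_nat q | q <- fin A].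

Definition NFA_membership (lev : forall k, lclass k) : seq bool -> Prop :=
  fun x => exists A, nfa_wf A /\ enc_nfa A = x /\ lev (alph A) (nfa_lang A).

Definition NFA_membership_bin (lev : forall k, lclass k) : seq bool -> Prop :=
  fun x => exists A, nfa_wf A /\ alph A = 2 /\ enc_nfa A = x /\
                     lev (alph A) (nfa_lang A).

(* Machine model: deterministic TM with a two-way read-only input tape *)
(* (with end markers), one work tape, and a write-only output tape.    *)
Inductive insym := LEnd | REnd | Bit of bool.
Inductive move := MLeft | MStay | MRight.

Record TM := TMk {
  nq : nat;
  ng : nat;  (* work symbols 'I_ng.+1, ord0 = blank *)
  q0 : 'I_nq.+1; qacc : 'I_nq.+1; qrej : 'I_nq.+1;
  delta : 'I_nq.+1 -> insym -> 'I_ng.+1 ->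
          'I_nq.+1 * 'I_ng.+1 * move * move * option bool }.

Record config (M : TM) := Cfg {
  st : 'I_(nq M).+1; ipos : nat; tape : nat -> 'I_(ng M).+1;
  wpos : nat; out : seq bool }.
Arguments Cfg {M}.
Arguments st {M}. Arguments ipos {M}. Arguments tape {M}.
Arguments wpos {M}. Arguments out {M}.

Definition read (x : seq bool) (i : nat) : insym :=
  if i is j.+1 then (if j < size x then Bit (nth false x j) else REnd) else LEnd.

Definition halted {M : TM} (c : config M) : bool :=
  (st c == qacc M) || (st c == qrej M).

Definition step {M : TM} (x : seq bool) (c : config M) : config M :=
  if halted c then c else
  match delta M (st c) (read x (ipos c)) (tape c (wpos c)) with
  | (q', g', mi, mw, o) =>
      Cfg q'
        (match mi with MLeft => (ipos c).-1 | MStay => ipos c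
                     | MRight => minn (ipos c).+1 (size x).+1 end)
        (fun j => if j == wpos c then g' else tape c j)
        (match mw with MLeft => (wpos c).-1 | MStay => wpos c
                     | MRight => (wpos c).+1 end)
        (out c ++ (if o is Some b then [:: b] else [::]))
  end.

Definition init_cfg (M : TM) (x : seq bool) : config M :=
  Cfg (q0 M) 0 (fun _ => ord0) 0 [::].

Definition conf (M : TM) (x : seq bool) (t : nat) : config M :=
  iter t (step x) (init_cfg M x).

Definition PSPACE (P : seq bool -> Prop) : Prop :=
  exists (M : TM) (c : nat), forall x,
    (forall t, wpos (conf M x t) < c * (size x) ^ c + c) /\
    exists t, halted (conf M x t) /\ (st (conf M x t) = qacc M <-> P x).

Definition logspace_computable (f : seq bool -> seq bool) : Prop :=
  exists (M : TM) (c : nat), forall x,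
    (forall t, wpos (conf M x t) < c * trunc_log 2 (size x) + c) /\
    exists t, halted (conf M x t) /\ out (conf M x t) = f x.

Definition PSPACE_hard (L : seq bool -> Prop) : Prop :=
  forall P, PSPACE P ->
    exists f, logspace_computable f /\ forall x, P x <-> L (f x).

(* Main.v *)
(* Every level contains the full language and consists of aperiodic languages: if L is
   in a level, then for m large enough u v^m w is in L iff u v^(m+1) w is. So one
   logspace reduction serves all levels at once: from a polynomial-space machine M and
   an input x, build an NFA over {0, 1} that is universal if M accepts x and has a
   non-aperiodic language otherwise.

   The NFA skips one bit and then guesses a component of the run of M on x: the control
   state together with the input head, or the work head, or a single tape cell. A word
   lists the rules that M is claimed to apply, and the chosen component, which needs only
   a role from a fixed finite set and one number modulo N (N polynomial in |x|), accepts
   as soon as the list is wrong about it. The only words on which no component finds a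
   mistake describe genuine runs; once such a run rejects, an extra letter may be repeated
   and must occur an even number of times for the word to escape acceptance.

   The encoded NFA is a concatenation, over a fixed list of items and all r < N, of a few
   unary numbers obtained from r; a Turing machine writes it by sweeping back and forth
   over two counters of logarithmic width. *)
From HB Require Import structures.
From Stdlib Require Import FunctionalExtensionality.
Require Import Defs.
From mathcomp Require Import all_boot zify.
Set Implicit Arguments.
Unset Strict Implicit.

(** * Levels are aperiodic *)

Section Aperiodic.
Variable k : nat.
Implicit Types (L : lang k) (u v w : seq 'I_k).

Definition pow v m : seq 'I_k := iter m (cat v) [::].

Lemma powS v m : pow v m.+1 = v ++ pow v m.
Proof. by []. Qed.

Lemma powD v m n : pow v (m + n) = pow v m ++ pow v n.
Proof. by elim: m => // m IH; rewrite addSn !powS IH catA. Qed.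

Definition aper_at N L := forall m u v w, N <= m ->
  (L (u ++ pow v m ++ w) <-> L (u ++ pow v m.+1 ++ w)).

Definition aperiodic L := exists N, aper_at N L.

Lemma aper_at_leq N N' L : N <= N' -> aper_at N L -> aper_at N' L.
Proof. by move=> le aN m u v w leN'; apply: aN; apply: leq_trans leN'. Qed.

Lemma aperiodic_ext L L' : (forall w, L w <-> L' w) -> aperiodic L -> aperiodic L'.
Proof.
move=> E [N aN]; exists N => m u v w le.
by split=> /E H; apply/E; apply/(aN m u v w le).
Qed.

(** Stated for an arbitrary connective so that union and intersection share one proof. *)
Lemma aperiodic2 (op : Prop -> Prop -> Prop) L1 L2 :
  (forall A B C D, (A <-> B) -> (C <-> D) -> (op A C <-> op B D)) ->
  aperiodic L1 -> aperiodic L2 -> aperiodic (fun w => op (L1 w) (L2 w)).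
Proof.
move=> opP [N1 a1] [N2 a2]; exists (N1 + N2) => m u v w le.
by apply: opP; [apply: a1 | apply: a2]; lia.
Qed.

Lemma split_marked (s1 s2 x y : seq 'I_k) a : s1 ++ s2 = x ++ a :: y ->
  (exists s, s1 = x ++ a :: s /\ y = s ++ s2) \/
  (exists s, x = s1 ++ s /\ s2 = s ++ a :: y).
Proof.
elim: s1 x => [|b s1 IH] [|c x] //=; first by right; exists [::].
- by move=> ?; right; exists (c :: x).
- by case=> <- <-; left; exists s1.
by case=> <- /IH [[s [-> ->]]|[s [-> ->]]]; [left | right]; exists s.
Qed.

Lemma split_pow v m x a y : pow v m = x ++ a :: y ->
  exists i j v1 v2, [/\ m = i + j.+1, v = v1 ++ a :: v2, x = pow v i ++ v1
    & y = v2 ++ pow v j].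
Proof.
elim: m x => [|m IH] x; first by case: x.
rewrite powS => /split_marked [[s [E ->]]|[s [-> /IH [i [j [v1 [v2 [-> E -> ->]]]]]]]].
  by exists 0, m, x, s.
by exists i.+1, j, v1, v2; split; rewrite // powS catA.
Qed.

(** The marking letter falls before, inside or after the power. Inside, it splits the power into [i]
    copies of [v], one copy containing the letter, and [j] copies; a high enough power leaves one
    side long enough to be pumped by the aperiodicity of its own factor. *)
Lemma aperiodic_marked L1 L2 a : aperiodic L1 -> aperiodic L2 ->
  aperiodic (fun w => exists u v, w = u ++ a :: v /\ L1 u /\ L2 v).
Proof.
move=> [N1 a1] [N2 a2].
pose N := N1 + N2.
have {}a1 : aper_at N L1 by apply: aper_at_leq a1; rewrite /N; lia.
have {}a2 : aper_at N L2 by apply: aper_at_leq a2; rewrite /N; lia.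
exists (N + N).+1 => m u v w leNm; split=> - [x [y [/split_marked]]].
- case=> [[s [-> ->]]|[s [-> /split_marked [[t [/split_pow P Ey]]|[t [-> ->]]]]]] [Lx Ly].
  + exists x, (s ++ pow v m.+1 ++ w); rewrite -catA; split=> //; split=> //.
    by apply: (proj1 (a2 m s v w _)) Ly; lia.
  + move: P => [i [j [v1 [v2 [Em Ev Es Et]]]]]; subst t y s.
    have Es p q : m.+1 = p + q.+1 -> u ++ pow v m.+1 ++ w =
        (u ++ pow v p ++ v1) ++ a :: (v2 ++ pow v q ++ w).
      by move=> ->; rewrite powD powS {2}Ev -!catA.
    (* Here [i + j = m - 1] is at least [2N], so a copy can be added on one of the sides. *)
    have [lei|lej] : N <= i \/ N <= j by lia.
      exists (u ++ pow v i.+1 ++ v1), (v2 ++ pow v j ++ w); split.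
        by apply: Es; lia.
      by split; [apply: (proj1 (a1 _ _ _ _ lei)) | rewrite catA].
    exists (u ++ pow v i ++ v1), (v2 ++ pow v j.+1 ++ w); split.
      by apply: Es; lia.
    by split=> //; apply: (proj1 (a2 _ _ _ _ lej)); rewrite catA.
  + exists (u ++ pow v m.+1 ++ t), y; split; first by rewrite -!catA.
    by split=> //; apply: (proj1 (a1 m u v t _)) Lx; lia.
- case=> [[s [-> ->]]|[s [-> /split_marked [[t [/split_pow P Ey]]|[t [-> ->]]]]]] [Lx Ly].
  + exists x, (s ++ pow v m ++ w); rewrite -catA; split=> //; split=> //.
    by apply: (proj2 (a2 m s v w _)) Ly; lia.
  + move: P => [i [j [v1 [v2 [Em Ev Es Et]]]]]; subst t y s.
    have Es p q : m = p + q.+1 -> u ++ pow v m ++ w =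
        (u ++ pow v p ++ v1) ++ a :: (v2 ++ pow v q ++ w).
      by move=> ->; rewrite powD powS {2}Ev -!catA.
    (* Now [i + j = m] is at least [2N + 1], so one side still has [N] copies after losing one. *)
    have [lei|lej] : N < i \/ N < j by lia.
      case: i Em Lx lei => // i Em Lx lei.
      exists (u ++ pow v i ++ v1), (v2 ++ pow v j ++ w); split.
        by apply: Es; lia.
      by split; [apply: (proj2 (a1 _ _ _ _ lei)) | rewrite catA].
    case: j Em Ly lej => // j Em Ly lej.
    exists (u ++ pow v i ++ v1), (v2 ++ pow v j ++ w); split.
      by apply: Es; lia.
    by split=> //; apply: (proj2 (a2 _ _ _ _ lej)); rewrite -catA in Ly.
  + exists (u ++ pow v m ++ t), y; split; first by rewrite -!catA.
    split=> //.
    by apply: (proj2 (a1 m u v t _)) Lx; lia.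
Qed.

Lemma aperiodic_mprod L0 (r : seq ('I_k * lang k)) : aperiodic L0 ->
  (forall q, List.In q r -> aperiodic q.2) -> aperiodic (mprod L0 r).
Proof.
elim: r L0 => //= -[a L1] r IH L0 a0 ar.
apply: aperiodic_marked => //; apply: IH; first exact: (ar (a, L1)) (or_introl _).
by move=> q qr; apply: ar; right.
Qed.

Lemma aperiodic_Pol (C : lclass k) : (forall L, C L -> aperiodic L) ->
  forall L, Pol C L -> aperiodic L.
Proof.
move=> aC L [ps [Cps E]].
apply: (aperiodic_ext (fun w => iff_sym (E w))).
elim: ps Cps {E} => [|p ps IH] Cps /=; first by exists 0 => m u v w _; split=> -[? []].
have aps : aperiodic (fun w => exists p, List.In p ps /\ mprod p.1 p.2 w).
  by apply: IH => q qps; apply: Cps; right.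
have ap : aperiodic (mprod p.1 p.2).
  have [Cp Cq] := Cps p (or_introl (erefl _)).
  by apply: aperiodic_mprod => [|q /Cq]; apply: aC.
apply: aperiodic_ext (@aperiodic2 or _ _ _ ap aps); last by move=> *; tauto.
move=> w; split=> [[H|[q [qps H]]]|[q [[<-|qps] H]]].
- by exists p; split=> //; left.
- by exists q; split=> //; right.
- by left.
by right; exists q.
Qed.

Lemma aperiodic_BoolCl (C : lclass k) : (forall L, C L -> aperiodic L) ->
  forall L, BoolCl C L -> aperiodic L.
Proof.
move=> aC L; elim=> {L} [L /aC //|L L' _ aL E||L1 L2 _ a1 _ a2|L1 L2 _ a1 _ a2|L _ [N aN]].
- exact: aperiodic_ext aL.
- by exists 0.
- by apply: (@aperiodic2 or _ _ _ a1 a2) => *; tauto.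
- by apply: (@aperiodic2 and _ _ _ a1 a2) => *; tauto.
by exists N => m u v w /aN H; split=> nL /H.
Qed.

(** For nonempty [v], a power beyond the maximal length in [s] makes both words too long to belong
    to [s]; for empty [v] the two words are equal. *)
Lemma aperiodic_finite (s : seq (seq 'I_k)) : aperiodic (fun w => w \in s).
Proof.
pose l := \max_(w <- s) size w.
have ls w : w \in s -> size w <= l by move=> ws; apply: leq_bigmax_seq.
exists l.+1 => m u v w lm.
case: v => [|a v]; first by elim: m {lm} => //= m ->.
have big i : l < i -> (u ++ pow (a :: v) i ++ w \in s) = false.
  move=> li; apply/negP => /ls; rewrite !size_cat.
  suff: i <= size (pow (a :: v) i) by lia.
  by elim: i {li} => //= i IH; rewrite size_cat; lia.
by rewrite !big // ltnW.
Qed.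

Lemma aperiodic_basis h L : basis h k L -> aperiodic L.
Proof.
case: h => [[] E|[s [] E]].
- by exists 0 => m u v w _; rewrite !E.
- by exists 0 => m u v w _; rewrite !E.
- exact: aperiodic_ext (fun w => iff_sym (E w)) (aperiodic_finite s).
have [N aN] := aperiodic_finite s.
exists N => m u v w le; have [H1 H2] := aN m u v w le; rewrite !E.
by split=> /negP H; apply/negP; auto.
Qed.

Lemma aperiodic_level h n half L : level h n half k L -> aperiodic L.
Proof.
have aF m : forall L, full_level (@basis h k) m L -> aperiodic L.
  elim: m => [|m IH] /= L'; first exact: aperiodic_basis.
  by apply: aperiodic_BoolCl; apply: aperiodic_Pol.
by case: half => /=; [apply: aperiodic_Pol (aF n) L | apply: aF].
Qed.

Lemma level_full h n half L : (forall w, L w) -> level h n half k L.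
Proof.
move=> fL.
have polC (C : lclass k) : C L -> Pol C L.
  (* A language is the marked product of itself with no letters. *)
  move=> CL; exists [:: (L, [::])]; split=> [p [<-|[]] //|w].
  by split=> [Lw|[p [[<-|[]]]] //]; exists (L, [::]); split=> //; left.
have aF : full_level (@basis h k) n L.
  elim: n => [|m IH] /=; last exact/bc_base/polC.
  by case: h; [right | exists [::]; right].
by case: half => //=; apply: polC.
Qed.
End Aperiodic.

(** * Turing machines over finite types *)

Section OptionCode.
Variable T : finType.

(** [None] is coded by [ord0], so it serves as the blank among work symbols and as the halting state
    among control states. *)
Definition ocode (o : option T) : 'I_#|T|.+1 :=
  if o is Some x then lift ord0 (enum_rank x) else ord0.
Definition odecode (i : 'I_#|T|.+1) : option T := omap enum_val (unlift ord0 i).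

Lemma ocodeK : cancel ocode odecode.
Proof.
by case=> [x|]; rewrite /odecode /ocode ?unlift_none // liftK /= enum_rankK.
Qed.

End OptionCode.
Arguments ocode : simpl never.
Arguments odecode : simpl never.

(** * Runs with a bounded work head *)

Section Reach.
Variables (M : TM) (x : seq bool) (b : nat).
Implicit Types c : config M.

(** The bound on the work head covers every intermediate configuration, so space bounds compose
    together with runs. *)
Definition reach c c' := exists k, iter k (step x) c = c' /\
  forall i, i <= k -> wpos (iter i (step x) c) < b.

Lemma reach_refl c : wpos c < b -> reach c c.
Proof. by move=> wb; exists 0; split=> // i; rewrite leqn0 => /eqP ->. Qed.

Lemma reach_step c c' c'' : wpos c < b -> step x c = c' -> reach c' c'' -> reach c c''.
Proof.
move=> wb E [k [Ek bk]]; exists k.+1; rewrite iterSr E; split=> // -[//|i] ik.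
by rewrite iterSr E; apply: bk.
Qed.

(** A halted configuration is a fixed point of [step], which extends the space bound from a finite
    run to all times. *)
Lemma reach_halted c c' : reach c c' -> halted c' ->
  (forall t, wpos (iter t (step x) c) < b) /\ exists t, iter t (step x) c = c'.
Proof.
move=> [k [Ek bk]] hc; split; last by exists k.
move=> t; case: (leqP t k) => [/bk //|kt].
suff -> : iter t (step x) c = c' by rewrite -Ek; apply: bk.
have -> : t = (t - k) + k by lia.
rewrite iterD Ek; elim: (t - k) => //= j ->.
by rewrite /step hc.
Qed.
End Reach.

Definition imove (x : seq bool) (m : move) (i : nat) : nat :=
  match m with MLeft => i.-1 | MStay => i | MRight => minn i.+1 (size x).+1 end.

Section FinTM.
Variables (Q G : finType) (q0 : Q).
Variable d : Q -> insym -> option G ->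
  option Q * option G * move * move * option bool.

(** Accepting and rejecting states coincide: for a transducer only halting and the output matter. *)
Definition fintm : TM :=
  @TMk #|Q| #|G| (ocode (Some q0)) ord0 ord0 (fun q a g =>
    if odecode q is Some q then
      let '(q', g', mi, mw, o) := d q a (odecode g) in
      (ocode q', ocode g', mi, mw, o)
    else (q, g, MStay, MStay, None)).

Definition tape_of (s : seq G) (j : nat) : 'I_(ng fintm).+1 := ocode (onth s j).

(* The work head scans the first cell of [r]; [q = None] is the halting state. *)
Definition zcfg (q : option Q) (i : nat) (l r : seq G) (o : seq bool) : config fintm :=
  @Cfg fintm (ocode q) i (tape_of (l ++ r)) (size l) o.

Lemma init_zcfg x : init_cfg fintm x = zcfg (Some q0) 0 [::] [::] [::].
Proof.
rewrite /init_cfg /zcfg; congr Cfg.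
by apply: functional_extensionality => j; rewrite /tape_of onth0n.
Qed.

Lemma zcfg_running q i l r o : halted (zcfg (Some q) i l r o) = false.
Proof. by []. Qed.

Section Step.
Variables (x : seq bool) (q : Q) (q' : option Q) (i : nat) (l r : seq G).
Variables (g' : option G) (mi mw : move) (o : seq bool) (ob : option bool).
Hypothesis dE : d q (read x i) (ohead r) = (q', g', mi, mw, ob).
Hypothesis wr : g' = None -> r = [::].

Let r' := oapp (cons^~ (behead r)) [::] g'.

(** By [wr] a blank is written only where nothing lies at or to the right of the head, so the tape
    remains a finite list of symbols followed by blanks. *)
Lemma step_zcfg : step x (zcfg (Some q) i l r o) =
  @Cfg fintm (ocode q') (imove x mi i) (tape_of (l ++ r'))
    (match mw with MLeft => (size l).-1 | MStay => size l | MRight => (size l).+1 end)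
    (o ++ seq_of_opt ob).
Proof.
have hd : onth (l ++ r) (size l) = ohead r.
  by rewrite onth_cat ltnn subnn; case: (r).
rewrite /step zcfg_running /= ocodeK /tape_of hd ocodeK dE.
congr Cfg.
apply: functional_extensionality => j; rewrite !onth_cat.
case: eqP => [->|nj]; rewrite ?ltnn ?subnn.
  by rewrite /r'; case: (g').
case: ltnP => // lj; congr ocode.
rewrite /r'; have := wr; case: (g') => [g _|/(_ erefl) ->] //=.
have -> : j - size l = (j - size l).-1.+1 by lia.
by case: (r) => /= *; rewrite ?onth0n.
Qed.
End Step.

Lemma step_stay x q q' i l r g' mi o ob :
  d q (read x i) (ohead r) = (q', g', mi, MStay, ob) -> (g' = None -> r = [::]) ->
  step x (zcfg (Some q) i l r o) =
  zcfg q' (imove x mi i) l (oapp (cons^~ (behead r)) [::] g') (o ++ seq_of_opt ob).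
Proof. by move=> dE wr; rewrite (step_zcfg _ _ dE wr). Qed.

Lemma step_left x q q' i l h r g' mi o ob :
  d q (read x i) (ohead r) = (q', g', mi, MLeft, ob) -> (g' = None -> r = [::]) ->
  step x (zcfg (Some q) i (rcons l h) r o) =
  zcfg q' (imove x mi i) l (h :: oapp (cons^~ (behead r)) [::] g') (o ++ seq_of_opt ob).
Proof.
by move=> dE wr; rewrite (step_zcfg _ _ dE wr) /zcfg cat_rcons size_rcons.
Qed.

Lemma step_right x q q' i l r g' mi o ob :
  d q (read x i) (ohead r) = (q', Some g', mi, MRight, ob) ->
  step x (zcfg (Some q) i l r o) =
  zcfg q' (imove x mi i) (rcons l g') (behead r) (o ++ seq_of_opt ob).
Proof.
by move=> dE; rewrite (step_zcfg _ _ dE) // /zcfg cat_rcons size_rcons.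
Qed.
End FinTM.

(** * Machines sweeping over a tape of columns *)

Section Sweep.
Variables (K : nat) (S Y : finType) (s0 : S).
Variable mealy : S -> Y -> S * Y.
Variable endf : S -> insym -> option S * option Y * move * K.-bseq bool.

(** A sweep runs [mealy] to the right over all columns, lets [endf] act at the first blank cell,
    prints the string chosen there and returns to cell 0. The length bound [K] keeps the set of
    control states finite. *)
Inductive sweepq :=
  | SRight of S | SEmit of option S & K.-bseq bool | SLeft of S | SInit.

Definition sweepq_sum (q : sweepq) : S + option S * K.-bseq bool + S + unit :=
  match q with
  | SRight s => inl (inl (inl s))
  | SEmit s e => inl (inl (inr (s, e)))
  | SLeft s => inl (inr s)
  | SInit => inr tt
  end.

Definition sum_sweepq (q : S + option S * K.-bseq bool + S + unit) : sweepq :=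
  match q with
  | inl (inl (inl s)) => SRight s
  | inl (inl (inr (s, e))) => SEmit s e
  | inl (inr s) => SLeft s
  | inr tt => SInit
  end.

Lemma sweepq_sumK : cancel sweepq_sum sum_sweepq.
Proof. by case. Qed.

HB.instance Definition _ := Equality.copy sweepq (can_type sweepq_sumK).
HB.instance Definition _ := Choice.copy sweepq (can_type sweepq_sumK).
HB.instance Definition _ := Countable.copy sweepq (can_type sweepq_sumK).
HB.instance Definition _ : isFinite sweepq := CanIsFinite sweepq_sumK.

(* The tape symbol [Some None] marks cell 0; the columns follow it. *)
Definition sweep_delta (q : sweepq) (a : insym) (g : option (option Y)) :
    option sweepq * option (option Y) * move * move * option bool :=
  match q, g with
  | SInit, _ => (Some (SRight s0), Some None, MStay, MRight, None)
  | SRight s, Some (Some y) =>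
      let (s', y') := mealy s y in
      (Some (SRight s'), Some (Some y'), MStay, MRight, None)
  | SRight s, None =>
      let '(s', app, mi, str) := endf s a in
      (Some (SEmit s' str), omap Some app, mi, MStay, None)
  | SEmit s' str, _ =>
      if val str is b :: str' then
        (Some (SEmit s' (insub_bseq K str')), g, MStay, MStay, Some b)
      else (omap SLeft s', g, MStay, MLeft, None)
  | SLeft s, Some (Some _) => (Some (SLeft s), g, MStay, MLeft, None)
  | SLeft s, Some None => (Some (SRight s), g, MStay, MRight, None)
  | _, _ => (None, g, MStay, MStay, None)
  end.

Definition sweep_tm : TM := fintm SInit sweep_delta.

Fixpoint mealy_run (s : S) (w : seq Y) : S * seq Y :=
  if w is y :: w' then
    let (s1, y1) := mealy s y in let (s2, w2) := mealy_run s1 w' in (s2, y1 :: w2)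
  else (s, [::]).

Lemma size_mealy_run s w : size (mealy_run s w).2 = size w.
Proof.
elim: w s => //= y w IH s; case: (mealy s y) => s1 y1.
by have := IH s1; case: (mealy_run s1 w) => s2 w2 /= ->.
Qed.

Notation zc := (@zcfg _ (option Y) SInit sweep_delta).

Lemma wpos_zc q i (l r : seq (option Y)) o : wpos (zc q i l r o) = size l.
Proof. by []. Qed.

Definition scfg (s : S) i (w : seq Y) o := zc (Some (SRight s)) i [:: None] (map Some w) o.

Section SweepRun.
Variables (x : seq bool) (b : nat).

Lemma reach_right s i (l : seq (option Y)) w o c : size l + size w < b ->
  reach x b (zc (Some (SRight (mealy_run s w).1)) i
               (l ++ map Some (mealy_run s w).2) [::] o) c ->
  reach x b (zc (Some (SRight s)) i l (map Some w) o) c.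
Proof.
elim: w s l => [|y w IH] s l /=; first by rewrite cats0.
case Em: (mealy s y) => [s1 y1].
case Er: (mealy_run s1 w) => [s2 w2] /= lb R.
apply: reach_step; first by rewrite wpos_zc; lia.
  by apply: step_right => /=; rewrite Em.
rewrite cats0; apply: IH; first by rewrite size_rcons; lia.
by rewrite Er /= cat_rcons.
Qed.

(** Printing keeps the head in place; the exhausted string triggers a step left onto [h]. *)
Lemma reach_emit s' (str : K.-bseq bool) i (l r : seq (option Y)) h o c : size l + 1 < b ->
  reach x b (zc (omap SLeft s') i l (h :: r) (o ++ str)) c ->
  reach x b (zc (Some (SEmit s' str)) i (rcons l h) r o) c.
Proof.
move=> lb; case: str => str /=.
elim: str o => [|e str IH] o Hs R.
  apply: reach_step R; first by rewrite wpos_zc size_rcons; lia.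
  rewrite (@step_left _ _ _ _ _ _ (omap SLeft s') i l h r (ohead r) MStay o None) //=.
    by case: (r).
  by case: (r).
have Hs' : size str <= K := ltnW Hs.
apply: reach_step (IH (rcons o e) Hs' _); first by rewrite wpos_zc size_rcons; lia.
  rewrite (@step_stay _ _ _ _ _ _ (Some (SEmit s' (insub_bseq K str))) i (rcons l h) r
    (ohead r) MStay o (Some e)) //=; last by case: (r).
  rewrite cats1; congr zcfg; last by case: (r).
  (* The tail is within the length bound, so [insub_bseq] does not fall back to its default. *)
  congr (Some (SEmit _ _)); apply: val_inj.
  by rewrite /insub_bseq insubdK.
by rewrite cat_rcons.
Qed.

(** Induction on the cells left of the head; only the marker in cell 0 ends the return. *)
Lemma reach_left s i w (l r : seq (option Y)) h o c : rcons l h = None :: map Some w ->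
  size w < b -> 1 < b -> reach x b (zc (Some (SRight s)) i [:: None] (map Some w ++ r) o) c ->
  reach x b (zc (Some (SLeft s)) i l (h :: r) o) c.
Proof.
move=> E wb b1 R.
elim/last_ind: l w h r E wb R => [|l h' IH] w h r E wb R.
  case: E wb R => -> /esym/eqP; case: w => // _ _ R; apply: reach_step R; first exact: ltnW.
  by rewrite (@step_right _ _ _ _ _ _ (Some (SRight s)) i [::] (None :: r) None MStay
       o None) //= cats0.
have [w' [y [Ew Eh El]]] : exists w' y, [/\ w = rcons w' y, h = Some y
    & rcons l h' = None :: map Some w'].
  case/lastP: w E {wb R} => [|w' y]; first by move/(congr1 size); rewrite !size_rcons.
  by rewrite map_rcons -rcons_cons => /rcons_inj [El ->]; exists w', y.
subst w h.
have szl : size l = size w'.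
  by move/(congr1 size): El; rewrite size_rcons /= size_map => -[].
apply: reach_step (IH w' h' (Some y :: r) El _ _).
- by rewrite wpos_zc size_rcons szl; move: wb; rewrite size_rcons.
- by rewrite (@step_left _ _ _ _ _ _ (Some (SLeft s)) i l h' (Some y :: r)
       (Some (Some y)) MStay o None) //= cats0.
- by move: wb; rewrite size_rcons; lia.
by move: R; rewrite map_rcons cat_rcons.
Qed.

Lemma reach_sweep s i w o s1 w1 s2 app mi str c : size w + 2 < b ->
  mealy_run s w = (s1, w1) -> endf s1 (read x i) = (Some s2, app, mi, str) ->
  reach x b (scfg s2 (imove x mi i) (w1 ++ seq_of_opt app) (o ++ str)) c ->
  reach x b (scfg s i w o) c.
Proof.
move=> wb Em Ee R.
have szw : size w1 = size w by have := size_mealy_run s w; rewrite Em.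
apply: reach_right; first by rewrite /=; lia.
rewrite Em /=.
apply: (@reach_step _ _ _ _ (zc (Some (SEmit (Some s2) str)) (imove x mi i)
  (None :: map Some w1) (map Some (seq_of_opt app)) o)).
- by rewrite wpos_zc /= size_map; lia.
- rewrite (@step_stay _ _ _ _ _ _ (Some (SEmit (Some s2) str)) i (None :: map Some w1)
    [::] (omap Some app) mi o None).
  + by rewrite cats0; case: app {Ee R}.
  + by rewrite /= Ee.
  + by [].
(* The marker makes the part left of the head nonempty, so there is a last cell [h] for the step
   left. *)
case/lastP El : {-}(None :: map Some w1) => [//|l h]; rewrite El.
have szl : size l = size w1 by move/(congr1 size): El; rewrite size_rcons /= size_map => -[].
apply: reach_emit; first by lia.
apply: (@reach_left _ _ w1); rewrite -?El //; try lia.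
by rewrite -map_cat.
Qed.

Lemma reach_sweep_halt s i w o s1 w1 app mi str : size w + 2 < b ->
  mealy_run s w = (s1, w1) -> endf s1 (read x i) = (None, app, mi, str) ->
  exists c, [/\ reach x b (scfg s i w o) c, halted c & out c = o ++ str].
Proof.
move=> wb Em Ee.
have szw : size w1 = size w by have := size_mealy_run s w; rewrite Em.
case/lastP El : {-}(None :: map Some w1) => [//|l h].
have szl : size l = size w1 by move/(congr1 size): El; rewrite size_rcons /= size_map => -[].
exists (zc None (imove x mi i) l (h :: map Some (seq_of_opt app)) (o ++ str)); split=> //.
apply: reach_right; first by rewrite /=; lia.
rewrite Em /=.
apply: (@reach_step _ _ _ _ (zc (Some (SEmit None str)) (imove x mi i)
  (None :: map Some w1) (map Some (seq_of_opt app)) o)).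
- by rewrite wpos_zc /= size_map; lia.
- rewrite (@step_stay _ _ _ _ _ _ (Some (SEmit None str)) i (None :: map Some w1)
    [::] (omap Some app) mi o None).
  + by rewrite cats0; case: app {Ee}.
  + by rewrite /= Ee.
  + by [].
rewrite El; apply: reach_emit; first by lia.
by apply: reach_refl; rewrite wpos_zc; lia.
Qed.

Lemma reach_start c : 1 < b ->
  reach x b (scfg s0 0 [::] [::]) c -> reach x b (init_cfg sweep_tm x) c.
Proof.
move=> b1 R; rewrite init_zcfg; apply: reach_step R; first exact: ltnW.
by rewrite (@step_right _ _ _ _ _ _ (Some (SRight s0)) 0 [::] [::] None MStay [::] None).
Qed.
End SweepRun.
End Sweep.

(** * Counters *)

Section CarryRun.
Variables (T : Type) (f : bool -> T -> bool * T).

Fixpoint carry_run (c : bool) (s : seq T) : bool * seq T :=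
  if s is d :: s' then
    let (c1, d1) := f c d in let (c2, s2) := carry_run c1 s' in (c2, d1 :: s2)
  else (c, [::]).

End CarryRun.

Variant shift := Zero | Same | Succ | Pred.

Definition shifted (N : nat) (m : shift) (r : nat) : nat :=
  match m with
  | Zero => 0 | Same => r | Succ => r.+1 %% N | Pred => (r + N.-1) %% N
  end.

Lemma shifted_lt N m r : r < N -> shifted N m r < N.
Proof. by case: m => /= rN; rewrite ?ltn_mod; lia. Qed.

Section Digits.
Variable B' : nat.
Notation B := B'.+1.

(* least significant digit first *)
Fixpoint digits (b W m : nat) : seq 'I_B :=
  if W is W'.+1 then inord (m %% b) :: digits b W' (m %/ b) else [::].

Lemma size_digits b W m : size (digits b W m) = W.
Proof. by elim: W m => //= W IH m; rewrite IH. Qed.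

Lemma digits_mod b W m : 0 < b -> digits b W (m %% b ^ W) = digits b W m.
Proof.
move=> b0; elim: W m => //= W IH m.
rewrite expnS modn_dvdm ?dvdn_mulr //; congr cons.
by rewrite -[RHS]IH mulnC modn_divl.
Qed.

Lemma digits0 b W : digits b W 0 = nseq W ord0.
Proof.
elim: W => //= W IH; rewrite mod0n div0n IH; congr cons.
by apply: val_inj; rewrite /= inordK.
Qed.

Lemma digits_expn b W : 1 < b -> digits b W.+1 (b ^ W) = rcons (digits b W 0) (inord 1).
Proof.
move=> b1; elim: W => [|W IH]; first by rewrite /= expn0 modn_small.
rewrite [LHS]/= -/(digits b W.+1 _) expnS mulKn ?(ltnW b1) // IH modnMr.
by rewrite [digits b W.+1 0]/= mod0n div0n.
Qed.

(** The base is separate from the digit alphabet because the same columns first count in base 2, to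
    measure the input, and then in base [B]. *)
Definition succ_digit (b : nat) (c : bool) (d : 'I_B) : bool * 'I_B :=
  if c then if d.+1 < b then (false, inord d.+1) else (true, ord0) else (false, d).

Definition pred_digit (c : bool) (d : 'I_B) : bool * 'I_B :=
  if c then if d == ord0 then (true, ord_max) else (false, inord d.-1) else (false, d).

Arguments succ_digit : simpl never.
Arguments pred_digit : simpl never.

Definition shift_digit (m : shift) (c : bool) (d : 'I_B) : bool * 'I_B :=
  match m with
  | Zero => (c, ord0) | Same => (c, d) | Succ => succ_digit B c d | Pred => pred_digit c d
  end.

Lemma carry_run_false f s : (forall d, f false d = (false, d)) ->
  carry_run f false s = (false, s) :> bool * seq 'I_B.
Proof. by move=> fE; elim: s => //= d s IH; rewrite fE IH. Qed.

Lemma succ_digits b W m : 0 < b <= B -> m < b ^ W ->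
  carry_run (succ_digit b) true (digits b W m) = (m.+1 == b ^ W, digits b W m.+1).
Proof.
move=> /andP[b0 bB]; elim: W m => [|W IH] m mW /=; first by case: m mW.
have mb : m %% b < b by rewrite ltn_mod.
have mdb : m %/ b < b ^ W by rewrite ltn_divLR // mulnC -expnS.
have Em := divn_eq m b.
rewrite [succ_digit _ _ (inord _)]/succ_digit inordK; last exact: leq_trans bB.
(* Either the low digit absorbs the carry, or it wraps to 0 and the carry passes to the quotient. *)
case: ltnP => [lt|ge].
  have Es : m.+1 = m %/ b * b + (m %% b).+1 by rewrite addnS -Em.
  rewrite carry_run_false //; congr (_, _ :: _).
  - apply/esym/negbTE/eqP => E; move: Es; rewrite E expnS => /(congr1 (modn^~ b)).
    by rewrite modnMr modnMDl modn_small.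
  - by rewrite Es modnMDl (modn_small lt).
  - by rewrite Es divnMDl // (divn_small lt) addn0.
have Es : m.+1 = (m %/ b).+1 * b by rewrite mulSn; lia.
rewrite IH // Es modnMl mulnK // expnS (mulnC b) eqn_pmul2r //.
by congr (_, _ :: _); apply: val_inj; rewrite /= inordK.
Qed.

Lemma digits_max W : digits B W (B ^ W).-1 = nseq W ord_max.
Proof.
elim: W => //= W IH.
have Es : (B ^ W.+1).-1 = (B ^ W).-1 * B + B'.
  by have := expn_gt0 B W; rewrite expnS; nia.
rewrite Es modnMDl divnMDl // modn_small // divn_small // addn0 IH.
by congr cons; apply: val_inj; rewrite /= inordK.
Qed.

Lemma pred_digits W m : m < B ^ W ->
  (carry_run pred_digit true (digits B W m)).2 = digits B W ((m + (B ^ W).-1) %% B ^ W).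
Proof.
move=> mW; have W0 : 0 < B ^ W by rewrite expn_gt0.
(* At 0 the borrow runs through all digits and leaves the largest number of [W] digits. *)
case: m mW => [_|m mW].
  rewrite add0n modn_small; last by lia.
  by rewrite digits_max digits0; elim: (W) => //= k; case: carry_run => c s /= ->.
have -> : m.+1 + (B ^ W).-1 = m + B ^ W by lia.
rewrite digits_mod //.
rewrite -(digits_mod _ (m + _)) // modnDr digits_mod //.
elim: W m {W0} mW => //= W IH m mW.
rewrite [pred_digit _ (inord _)]/pred_digit; case: eqP => [/(congr1 val)|/eqP].
  rewrite /= inordK ?ltn_mod // => E0.
  have Em := divn_eq m.+1 B; rewrite E0 addn0 in Em.
  case Eq: (m.+1 %/ B) Em => [|q] // Em.
  have Es : m = q * B + B' by lia.
  have qW : q.+1 < B ^ W by rewrite -Eq ltn_divLR // mulnC -expnS.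
  have := IH q qW; case: carry_run => c s /= ->.
  rewrite Es modnMDl divnMDl // modn_small // divn_small // addn0.
  by congr cons; apply: val_inj; rewrite /= inordK.
move=> n0; rewrite carry_run_false //=.
have {n0} n0 : m.+1 %% B != 0.
  by apply: contra n0 => /eqP E; apply/eqP/val_inj; rewrite /= inordK E.
have Em := divn_eq m.+1 B.
have Es : m = m.+1 %/ B * B + (m.+1 %% B).-1 by lia.
have lt : (m.+1 %% B).-1 < B by have := ltn_pmod m.+1 (ltn0Sn B'); lia.
rewrite inordK ?ltn_mod //.
rewrite {3 4}Es modnMDl divnMDl // (modn_small lt) (divn_small lt) addn0 //.
Qed.

Lemma shift_digits m W r : r < B ^ W ->
  (carry_run (shift_digit m) true (digits B W r)).2 = digits B W (shifted (B ^ W) m r).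
Proof.
move=> rW; case: m => /=.
- rewrite digits0; move: (digits _ _ _) (size_digits B W r) => s.
  by elim: s W {rW} => [|d s IH] [|W] //= [/IH]; case: carry_run => c t /= ->.
- by elim: (digits _ _ _) => //= d s; case: carry_run => c t /= ->.
- by rewrite digits_mod // succ_digits // ltn0Sn leqnn.
by rewrite pred_digits.
Qed.

(* [None] stands for equality, [Some true] for "less", [Some false] for "greater". *)
Definition compare_digit (q : option bool) (d e : 'I_B) : option bool :=
  if d < e then Some true else if d == e then q else Some false.

Fixpoint compare_run (q : option bool) (s t : seq 'I_B) : option bool :=
  match s, t with
  | d :: s', e :: t' => compare_run (compare_digit q d e) s' t'
  | _, _ => q
  end.

(** Digits arrive least significant first, so each later digit overrides the verdict so far unless
    the two digits are equal. *)
Lemma compare_digits W q m n : m < B ^ W -> n < B ^ W ->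
  compare_run q (digits B W m) (digits B W n) =
  if m < n then Some true else if m == n then q else Some false.
Proof.
elim: W q m n => [|W IH] q m n.
  by rewrite expn0 !ltnS !leqn0 => /eqP -> /eqP ->.
move=> mW nW /=.
have dW k : k < B ^ W.+1 -> k %/ B < B ^ W by rewrite ltn_divLR // mulnC -expnS.
rewrite IH ?dW // /compare_digit -!val_eqE /= !inordK ?ltn_mod //.
have Em := divn_eq m B; have En := divn_eq n B.
have := ltn_pmod m (ltn0Sn B'); have := ltn_pmod n (ltn0Sn B').
move: (m %/ B) (n %/ B) (m %% B) (n %% B) Em En => a b c d -> -> dB cB {IH mW nW dW}.
case: (ltngtP a b) => [ab|ab|->].
- by have -> : a * B + c < b * B + d by nia.
- have ge : b * B + d < a * B + c by nia.
  by rewrite ltnNge (ltnW ge) /= gtn_eqF.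
by rewrite ltn_add2l eqn_add2l.
Qed.
End Digits.

(** * A logarithmic-space transducer *)

(** With [v] the shifted value of [r], [plt] is printed for every counter value below [v] and [peq]
    once at [v]: this produces unary numbers. An item has two pieces so that it can print the source
    and the target of a transition. *)
Record piece := Piece { pshift : shift; plt : seq bool; peq : seq bool }.
Record item := Item { icond : insym -> bool; ipiece : bool -> piece }.

Definition piece_out (N r : nat) (p : piece) : seq bool :=
  flatten (nseq (shifted N (pshift p) r) (plt p)) ++ peq p.

Definition item_out (N : nat) (x : seq bool) (it : item) : seq bool :=
  flatten [seq if icond it (read x r)
               then piece_out N r (ipiece it false) ++ piece_out N r (ipiece it true)
               else [::] | r <- iota 0 N].

Definition items_out (N : nat) (x : seq bool) (its : seq item) : seq bool :=
  flatten [seq item_out N x it | it <- its].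

(** The number of binary digits of [n + 2], the number of input cells including both end markers. *)
Definition width (n : nat) : nat := (trunc_log 2 n.+2).+1.

Section Transducer.
Variables (B' : nat) (its : seq item).
Hypothesis B'gt0 : 0 < B'.
Notation B := B'.+1.
Notation ni := (size its).
Notation column := ('I_B * 'I_B)%type.

(** [Count] measures the input in binary, [Clear] resets both counters, and [Rewind] takes the input
    head back before an item. For each [r], [Compare] runs the second counter through all values for
    one piece, carrying the carry of the shift, the verdict of the comparison and the carry of the
    increment. [Advance] increments [r] in the first counter. *)
Inductive ctl :=
  | Count of bool
  | Clear
  | Rewind of 'I_ni
  | Compare of 'I_ni & bool & bool & option bool & bool
  | Advance of 'I_ni & bool.

Definition ctl_sum (s : ctl) :
    bool + unit + 'I_ni + 'I_ni * bool * bool * option bool * bool + 'I_ni * bool :=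
  match s with
  | Count c => inl (inl (inl (inl c)))
  | Clear => inl (inl (inl (inr tt)))
  | Rewind i => inl (inl (inr i))
  | Compare i k v q e => inl (inr (i, k, v, q, e))
  | Advance i c => inr (i, c)
  end.

Definition sum_ctl (s : bool + unit + 'I_ni + 'I_ni * bool * bool * option bool * bool
    + 'I_ni * bool) : ctl :=
  match s with
  | inl (inl (inl (inl c))) => Count c
  | inl (inl (inl (inr tt))) => Clear
  | inl (inl (inr i)) => Rewind i
  | inl (inr (i, k, v, q, e)) => Compare i k v q e
  | inr (i, c) => Advance i c
  end.

Lemma ctl_sumK : cancel ctl_sum sum_ctl.
Proof. by case. Qed.

HB.instance Definition _ := Equality.copy ctl (can_type ctl_sumK).
HB.instance Definition _ := Choice.copy ctl (can_type ctl_sumK).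
HB.instance Definition _ := Countable.copy ctl (can_type ctl_sumK).
HB.instance Definition _ : isFinite ctl := CanIsFinite ctl_sumK.

Definition item_size (it : item) : nat :=
  \sum_(k : bool) (size (plt (ipiece it k)) + size (peq (ipiece it k))).

Definition item_at (i : 'I_ni) : item := tnth (in_tuple its) i.
Notation K := (\max_(i < ni) item_size (item_at i)).

Definition piece_at (i : 'I_ni) (k : bool) : piece := ipiece (item_at i) k.

Lemma size_piece i k : size (plt (piece_at i k)) <= K /\ size (peq (piece_at i k)) <= K.
Proof.
have : item_size (item_at i) <= K by exact: (@leq_bigmax _ (fun i => item_size (item_at i))).
move: K => m; rewrite /item_size big_bool /piece_at /= => le; split; case: k; lia.
Qed.

(** In [Compare] the shifted value is produced digit by digit and compared with the old digits of
    the second counter during its increment; it is never stored on the tape. *)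
Definition ctl_mealy (s : ctl) (y : column) : ctl * column :=
  let (dr, de) := y in
  match s with
  | Count c => let (c', dr') := succ_digit 2 c dr in (Count c', (dr', de))
  | Clear => (Clear, (ord0, ord0))
  | Rewind i => (Rewind i, y)
  | Compare i k v q e =>
      let (v', dv) := shift_digit (pshift (piece_at i k)) v dr in
      let (e', de') := succ_digit B e de in
      (Compare i k v' (compare_digit q de dv) e', (dr, de'))
  | Advance i c => let (c', dr') := succ_digit B c dr in (Advance i c', (dr', de))
  end.

Definition compare_start (i : 'I_ni) (k : bool) : ctl := Compare i k true None true.
Definition goto (j : nat) : option ctl := omap Rewind (insub j).

Definition piece_str (p : piece) (q : option bool) : seq bool :=
  match q with Some true => plt p | None => peq p | Some false => [::] end.

(** A carry leaving the last column means that a counter has wrapped to 0: a new column in [Count],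
    the end of a piece in [Compare], the end of an item in [Advance]. *)
Definition ctl_end (s : ctl) (a : insym) : option ctl * option column * move * K.-bseq bool :=
  match s with
  | Count c =>
      let app := if c then Some (inord 1, ord0) else None in
      if a is REnd then (Some Clear, app, MStay, [bseq])
      else (Some (Count true), app, MRight, [bseq])
  | Clear => (goto 0, None, MStay, [bseq])
  | Rewind i =>
      if a is LEnd then (Some (compare_start i false), None, MStay, [bseq])
      else (Some (Rewind i), None, MLeft, [bseq])
  | Compare i k v q e =>
      (Some (if e then if k then Advance i true else compare_start i true
             else compare_start i k),
       None, MStay,
       if icond (item_at i) a then insub_bseq K (piece_str (piece_at i k) q) else [bseq])
  | Advance i c =>
      if c then (goto i.+1, None, MStay, [bseq])
      else (Some (compare_start i false), None, MRight, [bseq])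
  end.

Definition items_tm : TM := sweep_tm (Count true) ctl_mealy ctl_end.

Lemma mealy_count c s t : size s = size t ->
  mealy_run ctl_mealy (Count c) (zip s t) =
  (Count (carry_run (succ_digit 2) c s).1, zip (carry_run (succ_digit 2) c s).2 t).
Proof.
elim: s t c => [|d s IH] [|e t] c //= [/IH E].
by case: succ_digit => c1 d1; rewrite E; case: carry_run.
Qed.

Lemma mealy_advance i c s t : size s = size t ->
  mealy_run ctl_mealy (Advance i c) (zip s t) =
  (Advance i (carry_run (succ_digit B) c s).1, zip (carry_run (succ_digit B) c s).2 t).
Proof.
elim: s t c => [|d s IH] [|e t] c //= [/IH E].
by case: succ_digit => c1 d1; rewrite E; case: carry_run.
Qed.

Lemma mealy_clear w : mealy_run ctl_mealy Clear w = (Clear, nseq (size w) (ord0, ord0)).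
Proof. by elim: w => [|[d e] w IH] //; rewrite [LHS]/= IH. Qed.

Lemma mealy_rewind i w : mealy_run ctl_mealy (Rewind i) w = (Rewind i, w).
Proof. by elim: w => [|[d e] w IH] //; rewrite [LHS]/= IH. Qed.

Lemma mealy_compare i k v q e s t : size s = size t ->
  let dv := carry_run (shift_digit (pshift (piece_at i k))) v s in
  let de := carry_run (succ_digit B) e t in
  mealy_run ctl_mealy (Compare i k v q e) (zip s t) =
  (Compare i k dv.1 (compare_run q t dv.2) de.1, zip s de.2).
Proof.
elim: s t v q e => [|d s IH] [|d' t] v q e //= [/IH E].
case: (shift_digit _ v d) => v1 d1; case: (succ_digit _ e d') => e1 d1'; rewrite E.
by case: (carry_run (succ_digit _)); case: (carry_run (shift_digit _)).
Qed.

(** * Correctness of the transducer *)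

Section Run.
Variables (x : seq bool) (b : nat) (W : nat).
Notation N := (B ^ W).
Hypothesis bW : W + 2 < b.

Notation sc := (@scfg _ _ _ (Count true) ctl_mealy ctl_end).

(** [O] is the final output of the whole run, so the phases are verified backwards; for [s = None]
    the output must already be complete. *)
Definition halts_with (s : option ctl) i (w : seq column) o O : Prop :=
  if s is Some s then
    exists c, [/\ reach x b (sc s i w o) c, halted c & out c = O]
  else o = O.

Lemma halts_step s i w o s1 w1 s2 app mi (str : K.-bseq bool) O : size w <= W ->
  mealy_run ctl_mealy s w = (s1, w1) -> ctl_end s1 (read x i) = (s2, app, mi, str) ->
  halts_with s2 (imove x mi i) (w1 ++ seq_of_opt app) (o ++ str) O ->
  halts_with (Some s) i w o O.
Proof.
move=> wW Em Ee; case: s2 Ee => [s2|] Ee /=.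
  move=> [c [R hc oc]]; exists c; split=> //.
  by apply: reach_sweep Em Ee R; lia.
move=> <-; apply: reach_sweep_halt Em Ee; lia.
Qed.

Definition head_at r := minn r (size x).+1.

(** The input head stops at the right end marker while [r] keeps growing up to [N]; both read [REnd]
    from there on. *)
Lemma read_head r : read x (head_at r) = read x r.
Proof.
rewrite /head_at; case: (leqP r (size x).+1) => // rx; case: r rx => //= r rx.
by rewrite ltnn ifN // -leqNgt; lia.
Qed.

Notation dig := (digits B' B W).
Notation state r e := (zip (dig r) (dig e)).

Lemma size_state r e : size (state r e) = W.
Proof. by rewrite size_zip !size_digits minnn. Qed.

Definition compare_out (i : 'I_ni) k r e : seq bool :=
  let v := shifted N (pshift (piece_at i k)) r in
  if icond (item_at i) (read x r) then
    if e < v then plt (piece_at i k) else if e == v then peq (piece_at i k) else [::]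
  else [::].

Lemma compare_outs i k r : r < N -> flatten [seq compare_out i k r e | e <- iota 0 N] =
  if icond (item_at i) (read x r) then piece_out N r (piece_at i k) else [::].
Proof.
move=> rN; rewrite /compare_out; case: ifP => _; last first.
  by elim: (iota _ _).
have := shifted_lt (pshift (piece_at i k)) rN; rewrite /piece_out.
move: (shifted _ _ _) => v; move: (piece_at i k) => p vN /=.
have -> : iota 0 N = iota 0 v ++ v :: iota v.+1 (N - v.+1).
  by rewrite -{1}(subnKC vN) addSn -addnS iotaD add0n.
rewrite map_cat flatten_cat /= ltnn eqxx; congr (_ ++ _).
  have : all (fun e => e < v) (iota 0 v) by apply/allP => e; rewrite mem_iota => /andP[].
  rewrite -[v in nseq v _](size_iota 0).
  by elim: (iota _ _) => //= e s IH /andP[-> /IH ->].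
rewrite (_ : flatten _ = [::]) ?cats0 //.
have : all (fun e => v < e) (iota v.+1 (N - v.+1)).
  by apply/allP => e; rewrite mem_iota => /andP[].
by elim: (iota _ _) => //= e s IH /andP[ve /IH ->]; rewrite ltnNge ltnW //= gtn_eqF.
Qed.

Lemma step_compare i (k : bool) r e o O : r < N -> e < N ->
  halts_with (Some (if e.+1 == N then if k then Advance i true else compare_start i true
                    else compare_start i k))
    (head_at r) (state r (e.+1 %% N)) (o ++ compare_out i k r e) O ->
  halts_with (Some (compare_start i k)) (head_at r) (state r e) o O.
Proof.
move=> rN eN H.
apply: (halts_step _ (mealy_compare _ _ _ _ _ _) (erefl _));
  rewrite ?size_digits ?size_state //.
rewrite shift_digits // succ_digits ?ltn0Sn ?leqnn //= read_head cats0.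
rewrite compare_digits ?shifted_lt // -(digits_mod B' W e.+1) //.
congr (halts_with _ _ _ (_ ++ _) _): H; rewrite /compare_out; case: (icond _ _) => //.
(* The printed string fits the bound on emitted strings, so it is not replaced by a default. *)
have [lt_p le_p] := size_piece i k.
rewrite /insub_bseq; case: ifP => _; first by rewrite insubdK.
by case: ifP => _ //; rewrite insubdK.
Qed.

Lemma run_compare i (k : bool) r n e o O : r < N -> e + n.+1 = N ->
  halts_with (Some (if k then Advance i true else compare_start i true)) (head_at r)
    (state r 0) (o ++ flatten [seq compare_out i k r j | j <- iota e n.+1]) O ->
  halts_with (Some (compare_start i k)) (head_at r) (state r e) o O.
Proof.
move=> rN; elim: n e o => [|n IH] e o en H; apply: step_compare => //; try lia.
  have -> : e.+1 = N by lia.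
  by rewrite eqxx modnn; move: H; rewrite /= cats0.
rewrite ltn_eqF ?modn_small; try lia.
by apply: IH; [lia | rewrite -catA].
Qed.

Definition row_out (it : item) r : seq bool :=
  if icond it (read x r)
  then piece_out N r (ipiece it false) ++ piece_out N r (ipiece it true) else [::].

Lemma run_row i r o O : r < N ->
  halts_with (Some (Advance i true)) (head_at r) (state r 0) (o ++ row_out (item_at i) r) O ->
  halts_with (Some (compare_start i false)) (head_at r) (state r 0) o O.
Proof.
move=> rN H; have eN : 0 + N.-1.+1 = N by lia.
apply: (run_compare rN eN); apply: (run_compare rN eN).
rewrite (_ : N.-1.+1 = N); last by lia.
rewrite -catA !compare_outs //; congr (halts_with _ _ _ (_ ++ _) _): H.
by rewrite /row_out; case: ifP.
Qed.

Lemma step_advance (i : 'I_ni) r o O : r < N ->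
  (if r.+1 == N then halts_with (goto i.+1) (head_at r) (state 0 0) o O
   else halts_with (Some (compare_start i false)) (head_at r.+1) (state r.+1 0) o O) ->
  halts_with (Some (Advance i true)) (head_at r) (state r 0) o O.
Proof.
move=> rN.
have E : mealy_run ctl_mealy (Advance i true) (state r 0) =
    (Advance i (r.+1 == N), state r.+1 0).
  by rewrite mealy_advance ?size_digits // succ_digits ?ltn0Sn ?leqnn.
case: eqP E => [rE|_] E H; apply: (halts_step _ E (erefl _));
  rewrite ?size_state //= ?cats0 //.
  by rewrite -(digits_mod B' W r.+1) // rE modnn.
congr (halts_with _ _ _ _ _): H; rewrite /head_at; lia.
Qed.

Lemma run_rows (i : 'I_ni) r n o O : r + n.+1 = N ->
  (forall h, halts_with (goto i.+1) h (state 0 0)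
     (o ++ flatten [seq row_out (item_at i) j | j <- iota r n.+1]) O) ->
  halts_with (Some (compare_start i false)) (head_at r) (state r 0) o O.
Proof.
elim: n r o => [|n IH] r o rn H; (apply: run_row; first lia); (apply: step_advance; first lia).
  by rewrite addn1 in rn; rewrite rn eqxx; have := H (head_at r); rewrite /= cats0.
rewrite ltn_eqF; last by lia.
by apply: IH => [|h]; [lia | rewrite -catA; apply: H].
Qed.

Lemma run_rewind i h o O :
  halts_with (Some (compare_start i false)) 0 (state 0 0) o O ->
  halts_with (Some (Rewind i)) h (state 0 0) o O.
Proof.
move=> H; elim: h => [|h IH].
  have E := mealy_rewind i (state 0 0).
  by apply: (@halts_step _ 0 _ _ _ _ _ _ _ _ _ _ E (erefl _)); rewrite ?size_state //= !cats0.
apply: (@halts_step _ _ _ _ _ _ (Some (Rewind i)) None MLeft [bseq] _ _ (mealy_rewind _ _)).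
- by rewrite size_state.
- by rewrite /=; case: ifP.
by rewrite /= !cats0.
Qed.

Lemma run_items j n h o O : j + n = ni ->
  o ++ flatten [seq item_out N x it | it <- drop j its] = O ->
  halts_with (goto j) h (state 0 0) o O.
Proof.
elim: n j h o => [|n IH] j h o jn H; rewrite /goto.
  by move: H; rewrite insubF ?drop_oversize ?cats0 //; lia.
have ltj : j < ni by lia.
rewrite insubT /=; apply: run_rewind.
have N0 : 0 < N by rewrite expn_gt0.
rewrite (_ : 0 = head_at 0) //.
apply: (@run_rows _ 0 N.-1) => [|h']; first by lia.
apply: IH => /=; first by lia.
rewrite -H; have -> : drop j its = item_at (Ordinal ltj) :: drop j.+1 its.
  rewrite (drop_nth (item_at (Ordinal ltj))) //; congr cons.
  by rewrite [RHS](tnth_nth (item_at (Ordinal ltj))).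
rewrite [map _ (_ :: _)]/= [flatten (_ :: _)]/= -catA /item_out.
by have -> : iota 0 N = 0 :: iota 1 N.-1 by rewrite -{1}(prednK N0).
Qed.

Hypothesis W_width : W = width (size x).

Definition count_state k m : seq column := zip (digits B' 2 k m) (nseq k ord0).

Lemma size_count_state k m : size (count_state k m) = k.
Proof. by rewrite size_zip size_digits size_nseq minnn. Qed.

Lemma mealy_count_state k m : m < 2 ^ k ->
  mealy_run ctl_mealy (Count true) (count_state k m) =
  (Count (m.+1 == 2 ^ k), count_state k m.+1).
Proof. by move=> mk; rewrite mealy_count ?size_digits ?size_nseq // succ_digits. Qed.

(** On overflow [m + 1] is [2 ^ k]: the [k] digits have wrapped to 0 and the appended column
    supplies the leading 1. *)
Lemma count_state_grow k m (c := m.+1 == 2 ^ k) :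
  count_state k m.+1 ++ seq_of_opt (if c then Some (inord 1, ord0) else None) =
  count_state (if c then k.+1 else k) m.+1.
Proof.
rewrite /c; case: eqP => [->|_]; last by rewrite cats0.
rewrite /count_state digits_expn // -(digits_mod B' k (2 ^ k)) // modnn.
have -> : nseq k.+1 ord0 = rcons (nseq k (@ord0 B')) ord0.
  by elim: (k) => //= k2 {1}->.
by rewrite zip_rcons ?size_digits ?size_nseq // cats1.
Qed.

(** The bounds on [k] say that it is the binary length of [m], hence at most [W] throughout. *)
Lemma run_count n m k O : m + n = (size x).+1 -> m < 2 ^ k -> 2 ^ k <= 2 * m \/ k = 0 ->
  halts_with (goto 0) (size x).+1 (state 0 0) [::] O ->
  halts_with (Some (Count true)) m (count_state k m) [::] O.
Proof.
move=> + + + H; elim: n m k => [|n IH] m k mn mk km.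
all: have kleW : size (count_state k m) <= W.
1,3: rewrite size_count_state W_width; case: km => [|-> //]; case: (k) => // k' km.
1,2: rewrite /width ltnS trunc_log_max //; move: km; rewrite expnS; lia.
all: have E := mealy_count_state mk.
all: have G := count_state_grow k m.
all: have [mk1 km1] : let k1 := if m.+1 == 2 ^ k then k.+1 else k in
    m.+1 < 2 ^ k1 /\ 2 ^ k1 <= 2 * m.+1.
1,3: rewrite /=; case: eqP => [->|ne]; [rewrite expnS; lia | split; first by lia].
1,2: by case: km => [|k0]; [lia | move: mk ne; rewrite k0 expn0; lia].
- apply: (@halts_step _ _ _ _ _ _ (Some Clear)
    (if m.+1 == 2 ^ k then Some (inord 1, ord0) else None) MStay [bseq] _ kleW E).
    have -> : m = (size x).+1 by lia.
    by rewrite /= ltnn.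
  rewrite G /=.
  (* At the right end marker the counter reaches [size x + 2], whose binary length is the width. *)
  have EW : (if m.+1 == 2 ^ k then k.+1 else k) = W.
    rewrite W_width /width (_ : (size x).+2 = m.+1); last by lia.
    case: (if _ then _ else _) mk1 km1 => // k2 lt ge; rewrite (@trunc_log_eq 2 k2) //.
    by rewrite lt andbT -(leq_pmul2l (ltn0Sn 1)) -expnS.
  rewrite EW; apply: (halts_step _ (mealy_clear _) (erefl _)).
    by rewrite size_count_state.
  rewrite /= cats0 size_count_state.
  have -> : m = (size x).+1 by lia.
  rewrite (_ : nseq W _ = state 0 0) // digits0.
  by elim: (W) => //= W' ->.
apply: (@halts_step _ _ _ _ _ _ (Some (Count true))
  (if m.+1 == 2 ^ k then Some (inord 1, ord0) else None) MRight [bseq] _ kleW E).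
  by rewrite /=; case: (m) mn => //= m' mn; rewrite ifT //; lia.
rewrite G /= (_ : minn _ _ = m.+1); last by lia.
by apply: IH => //; [lia | left].
Qed.

Lemma items_tm_halts : exists c, [/\ reach x b (init_cfg items_tm x) c, halted c
  & out c = items_out N x its].
Proof.
have [c [R hc oc]] : halts_with (Some (Count true)) 0 (count_state 0 0) [::] (items_out N x its).
  apply: (@run_count (size x).+1) => //; first by right.
  by apply: (@run_items 0 ni); rewrite ?drop0.
by exists c; split=> //; apply: reach_start R; lia.
Qed.
End Run.
End Transducer.

Theorem logspace_items B' its : 0 < B' ->
  logspace_computable (fun x => items_out (B'.+1 ^ width (size x)) x its).
Proof.
move=> B'0; exists (items_tm B' its), 6 => x.
have wb : width (size x) + 2 < 6 * trunc_log 2 (size x) + 6.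
  (* Passing from [n] to [n + 2] raises the logarithm by at most 2, so the width plus 2 is at most
     the logarithm of [n] plus 5. *)
  have : trunc_log 2 (size x).+2 <= (trunc_log 2 (size x)).+2.
    rewrite -ltnS -(ltn_exp2l _ _ (ltnSn 1)).
    have [x0|x0] := posnP (size x); first by rewrite x0.
    have := trunc_log_ltn (size x) (ltnSn 1).
    have := trunc_logP (ltnSn 1) (ltn0Sn (size x).+1).
    by rewrite !expnS; lia.
  by rewrite /width; lia.
have [c [R hc oc]] := items_tm_halts its B'0 wb (erefl _).
have [bd [t Et]] := reach_halted R hc.
by split=> //; exists t; rewrite /conf Et.
Qed.

(** * The reduction *)

Definition insym_option (a : insym) : option (option bool) :=
  match a with LEnd => None | REnd => Some None | Bit b => Some (Some b) end.
Definition option_insym (o : option (option bool)) : insym :=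
  match o with None => LEnd | Some None => REnd | Some (Some b) => Bit b end.

Lemma insym_optionK : cancel insym_option option_insym.
Proof. by case. Qed.

HB.instance Definition _ := Equality.copy insym (can_type insym_optionK).
HB.instance Definition _ := Choice.copy insym (can_type insym_optionK).
HB.instance Definition _ := Countable.copy insym (can_type insym_optionK).
HB.instance Definition _ : isFinite insym := CanIsFinite insym_optionK.

Lemma read_LEnd x i : (read x i == LEnd) = (i == 0).
Proof. by case: i => //= i; case: ifP. Qed.

Lemma read_REnd x i : (read x i == REnd) = (size x < i).
Proof. by case: i => //= i; rewrite ltnS; case: ltnP. Qed.

Lemma In_cat T (a : T) s1 s2 : List.In a (s1 ++ s2) <-> List.In a s1 \/ List.In a s2.
Proof. by elim: s1 => /= [|b s1 ->]; tauto. Qed.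

Section Computation.
Variables (M : TM) (x : seq bool).

Lemma conf_halted t t' : halted (conf M x t) -> t <= t' -> conf M x t' = conf M x t.
Proof.
move=> h tt'; rewrite /conf -(subnK tt') iterD -/(conf M x t).
by elim: (t' - t) => //= k ->; rewrite /step h.
Qed.

Lemma ipos_conf t : ipos (conf M x t) <= (size x).+1.
Proof.
elim: t => // t; rewrite /conf iterS -/(conf M x t) /step; case: ifP => // _.
by case: delta => [[[[q g] mi] mw] o] /=; case: mi; lia.
Qed.
End Computation.

(** * The automaton of components *)

Section Automaton.
Variable M : TM.
Notation Q := 'I_(nq M).+1.
Notation G := 'I_(ng M).+1.

(* The letters are [option event]: a rule (state, input symbol, work symbol, is the work
   head at cell 0?), or the extra letter [None]. A letter is written in binary as
   1^k 0, and [progress] counts the 1s read so far. *)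
Notation event := (Q * insym * G * bool)%type.
Notation progress := 'I_#|{: event}|.+1.

(* The number accompanying [Main] is the input head position and that of [Head] the work
   head position; for the cell j with content [g] in [Cell g] it is (work head - j) mod N,
   so that only a test for 0 is ever needed. *)
Variant role := Sink | Main of Q & bool | Head | Cell of G.

Definition role_sum (t : role) : unit + Q * bool + unit + G :=
  match t with
  | Sink => inl (inl (inl tt)) | Main q par => inl (inl (inr (q, par)))
  | Head => inl (inr tt) | Cell g => inr g
  end.
Definition sum_role (t : unit + Q * bool + unit + G) : role :=
  match t with
  | inl (inl (inl tt)) => Sink | inl (inl (inr (q, par))) => Main q par
  | inl (inr tt) => Head | inr g => Cell g
  end.

Lemma role_sumK : cancel role_sum sum_role.
Proof. by case. Qed.

HB.instance Definition _ := Equality.copy role (can_type role_sumK).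
HB.instance Definition _ := Choice.copy role (can_type role_sumK).
HB.instance Definition _ := Countable.copy role (can_type role_sumK).
HB.instance Definition _ : isFinite role := CanIsFinite role_sumK.

(** The model allows [qacc] and [qrej] to coincide; such a state counts as accepting. *)
Definition rejecting (q : Q) : bool := (q == qrej M) && (q != qacc M).

Definition input_shift (mi : move) (a : insym) : shift :=
  match mi with
  | MLeft => if a == LEnd then Same else Pred
  | MStay => Same
  | MRight => if a == REnd then Same else Succ
  end.

Definition work_shift (mw : move) (z : bool) : shift :=
  match mw with
  | MLeft => if z then Same else Pred | MStay => Same | MRight => Succ
  end.

(** The test [a == LEnd] asks whether the number of the role is 0, because [read x r] is [LEnd]
    exactly for [r = 0]; thus a transition depends on [r] only through [read x r]. The extra letter
    flips the parity of [Main] in a rejecting state, sends [Main] to [Sink] elsewhere, and leaves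
    the other roles alone. *)
Definition read_letter (t : role) (a : insym) (l : option event) : role * shift :=
  if l is Some (q, a', g, z) then
    let '(q', g', mi, mw, _) := delta M q a' g in
    match t with
    | Sink => (Sink, Same)
    | Main q1 par =>
        if [&& q1 != qacc M, q1 != qrej M, q1 == q & a == a']
        then (Main q' par, input_shift mi a) else (Sink, Same)
    | Head => if z == (a == LEnd) then (Head, work_shift mw z) else (Sink, Same)
    | Cell g1 =>
        if a == LEnd then
          if g1 == g then (Cell g', work_shift mw z) else (Sink, Same)
        else (Cell g1, work_shift mw z)
    end
  else if t is Main q par then
    (if rejecting q then Main q (~~ par) else Sink, Same)
  else (t, Same).

Notation bstate := (role * progress)%type.

Definition read_bit (s : bstate) (a : insym) (b : bool) : bstate * shift :=
  let (t, c) := s in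
  if b then (if insub c.+1 is Some c' then (t, c') else (Sink, ord0), Same)
  else let (t', sh) := read_letter t a (odecode c) in ((t', ord0), sh).

Notation nstate := (option bstate).
Notation K := #|{: nstate}|.

(** [None] is the initial state. [Main] withholds acceptance only at a letter boundary, in a
    rejecting state, after an even number of extra letters. *)
Definition final (s : nstate) : bool :=
  match s with
  | None | Some (Sink, _) => true
  | Some (Main q par, c) => ~~ [&& rejecting q, ~~ par & c == ord0]
  | _ => false
  end.

Record schema := Schema {
  scond : insym -> bool;
  ssrc : nstate; sshift : shift; sbit : bool;
  stgt : nstate; tshift : shift }.

(** With a single initial state and no silent moves, the first bit is spent on choosing a component.
    The condition [pred1 LEnd] yields one transition each for [Main] and [Head], while [Cell] gets
    one for every [r]. *)
Definition start_schemas (b : bool) : seq schema :=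
  [:: Schema (pred1 LEnd) None Zero b (Some (Main (q0 M) false, ord0)) Zero;
      Schema (pred1 LEnd) None Zero b (Some (Head, ord0)) Zero;
      Schema predT None Zero b (Some (Cell ord0, ord0)) Same].

Definition step_schema (u : bstate * insym * bool) : schema :=
  let '(s, a, b) := u in
  let (s', sh) := read_bit s a b in
  Schema (pred1 a) (Some s) Same b (Some s') sh.

Definition schemas : seq schema :=
  start_schemas true ++ start_schemas false ++
  [seq step_schema u | u <- enum {: bstate * insym * bool}].

(** In unary this is [r] blocks of [K] ones followed by the rank, which is what a piece prints. *)
Definition num (s : nstate) (r : nat) : nat := r * K + enum_rank s.

Lemma num_inj s s' r r' : num s r = num s' r' -> s = s' /\ r = r'.
Proof.
rewrite /num => E; have K0 : 0 < K by apply/card_gt0P; exists None.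
have Er : r = r'.
  have := congr1 (divn^~ K) E.
  by rewrite !divnMDl // !divn_small ?addn0 // ltn_ord.
by split=> //; apply/enum_rank_inj/val_inj; move: E; rewrite Er => /addnI.
Qed.

Section Reduction.
Variables (x : seq bool) (N : nat).
Hypothesis N0 : 0 < N.

Definition strans (s : schema) (r : nat) : nat * nat * nat :=
  (num (ssrc s) (shifted N (sshift s) r), nat_of_bool (sbit s),
   num (stgt s) (shifted N (tshift s) r)).

Definition redtrans : seq (nat * nat * nat) :=
  flatten [seq flatten [seq if scond s (read x r) then [:: strans s r] else [::]
                       | r <- iota 0 N] | s <- schemas].

Definition finals : seq nstate := [seq s <- enum {: nstate} | final s].

Definition red_nfa : nfa :=
  NFA 2 (N * K) (enum_rank (None : nstate)) redtrans
    (flatten [seq [seq num s r | r <- iota 0 N] | s <- finals]).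

Lemma redtransP tr : reflect
  (exists s r, [/\ List.In s schemas, r < N, scond s (read x r) & tr = strans s r])
  (tr \in redtrans).
Proof.
rewrite /redtrans; elim: schemas => [|s ss IH] /=.
  by constructor=> -[? [? []]].
rewrite mem_cat; apply: (iffP orP) => [[/flatten_mapP [r]|/IH [s' [r []]]]|].
- rewrite mem_iota => rN; case: ifP => // sr; rewrite inE => /eqP ->.
  by exists s, r; split; [left | | |].
- by move=> *; exists s', r; split=> //; right.
case=> s' [r [[->|Is] rN sr E]]; last by right; apply/IH; exists s', r.
by left; apply/flatten_mapP; exists r; rewrite ?mem_iota // sr inE E.
Qed.

Definition rstep (p : bstate * nat) (b : bool) : bstate * nat :=
  let (s', sh) := read_bit p.1 (read x p.2) b in (s', shifted N sh p.2).

Definition run (p : bstate * nat) (w : seq bool) : bstate * nat := foldl rstep p w.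

Lemma In_step_schemas s : List.In s [seq step_schema u | u <- enum {: bstate * insym * bool}]
  <-> exists u, s = step_schema u.
Proof.
split=> [|[u ->]].
  by elim: (enum _) => //= u us IH [<-|/IH]; first by exists u.
have : u \in enum {: bstate * insym * bool} by rewrite mem_enum.
by elim: (enum _) => //= v us IH; rewrite inE => /orP [/eqP ->|/IH]; [left | right].
Qed.

Lemma mem_final s r : r < N -> (num s r \in fin red_nfa) = final s.
Proof.
move=> rN; apply/flatten_mapP/idP => [[s']|fs].
  by rewrite mem_filter => /andP[fs _] /mapP [r' _ /num_inj [-> _]].
exists s; first by rewrite mem_filter fs mem_enum.
by apply: map_f; rewrite mem_iota.
Qed.

(** After the first bit the automaton is deterministic: for a state, a symbol [read x r] and a bit,
    exactly one step schema applies. *)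
Lemma acc_run s r w : r < N ->
  acc_from red_nfa (num (Some s) r) (map nat_of_bool w) <-> final (Some (run (s, r) w).1).
Proof.
elim: w s r => [|b w IH] s r rN /=; first by rewrite mem_final.
case E : (rstep (s, r) b) => [s' r'].
have r'N : r' < N.
  by move: E; rewrite /rstep; case: read_bit => s1 sh [_ <-]; apply: shifted_lt.
rewrite -(IH s' r') //; split=> [[q [/redtransP [sc [r1 [Is r1N c1 Etr]]]]]|acc].
  move: Is; rewrite /schemas !In_cat In_step_schemas.
  case=> [|[|[[[s2 a] b2] Eu]]].
  (* Start schemas leave from [None], unlike the present state. *)
  - by case=> [|[|[|[]]]] Es; move: Etr; rewrite -Es => -[/num_inj [] ].
  - by case=> [|[|[|[]]]] Es; move: Etr; rewrite -Es => -[/num_inj [] ].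
  move: Etr c1; rewrite Eu /=; case Eb : (read_bit s2 a b2) => [s3 sh] /=.
  case=> /num_inj [[Es] Er] Ebb -> /eqP ra; subst s2 r1.
  have Eb2 : b = b2 by case: (b) (b2) Ebb => -[].
  move: E; rewrite /rstep /= ra Eb2 Eb => -[-> ->] //.
exists (num (Some s') r'); split=> //; apply/redtransP.
exists (step_schema (s, read x r, b)), r.
split=> //.
- rewrite /schemas !In_cat; right; right; apply/In_step_schemas.
  by exists (s, read x r, b).
- by rewrite /=; case: read_bit => /= *.
- by move: E; rewrite /rstep /=; case: read_bit => s1 sh /= [-> <-].
Qed.

Lemma acc_init b w : acc_from red_nfa (init red_nfa) (map nat_of_bool (b :: w)) <->
  [\/ final (Some (run ((Main (q0 M) false, ord0), 0) w).1),
      final (Some (run ((Head, ord0), 0) w).1)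
    | exists2 r, r < N & final (Some (run ((Cell ord0, ord0), r) w).1)].
Proof.
have Ei : init red_nfa = num None 0 by [].
rewrite Ei /=; split=> [[q [/redtransP [sc [r [Is rN c Etr]]]]]|].
  move: Is; rewrite /schemas !In_cat In_step_schemas.
  case=> [|[|[[[s2 a] b2] Eu]]].
  - case=> [|[|[|[]]]] Es; move: Etr; rewrite -Es => -[_ -> /acc_run H].
    + by constructor 1; apply: H.
    + by constructor 2; apply: H.
    + by constructor 3; exists r => //; apply: H.
  - case=> [|[|[|[]]]] Es; move: Etr; rewrite -Es => -[_ -> /acc_run H].
    + by constructor 1; apply: H.
    + by constructor 2; apply: H.
    + by constructor 3; exists r => //; apply: H.
  by move: Etr; rewrite Eu /=; case: read_bit => ? ? [/num_inj []].
have Ib sc : List.In sc (start_schemas b) -> List.In sc schemas.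
  by rewrite /schemas !In_cat; case: (b); tauto.
case=> [H|H|[r rN H]].
- exists (num (Some (Main (q0 M) false, ord0)) 0); split; last exact/acc_run.
  by apply/redtransP; eexists _, 0; split; [exact: (Ib _ (or_introl erefl)) | | |].
- exists (num (Some (Head, ord0)) 0); split; last exact/acc_run.
  by apply/redtransP; eexists _, 0; split; [exact: (Ib _ (or_intror (or_introl erefl))) | | |].
exists (num (Some (Cell ord0, ord0)) r); split; last exact/acc_run.
by apply/redtransP; eexists _, r; split;
   [exact: (Ib _ (or_intror (or_intror (or_introl erefl)))) | | |].
Qed.

(** * Components follow the computation *)

Section Simulation.
Hypothesis wposN : forall t, wpos (conf M x t) < N.
Hypothesis sizeN : (size x).+1 < N.
Notation cf := (conf M x).

(* [None] is the main component, [Some None] the work head, [Some (Some j)] cell [j]. *)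
Notation component := (option (option nat)).

Definition valid (k : component) : bool := if k is Some (Some j) then j < N else true.

Definition cell_pos (w j : nat) : nat := (w + (N - j)) %% N.

Definition comp_state (t : nat) (k : component) : role * nat :=
  match k with
  | None => (Main (st (cf t)) false, ipos (cf t))
  | Some None => (Head, wpos (cf t))
  | Some (Some j) => (Cell (tape (cf t) j), cell_pos (wpos (cf t)) j)
  end.

Definition event_at (t : nat) : event :=
  (st (cf t), read x (ipos (cf t)), tape (cf t) (wpos (cf t)), wpos (cf t) == 0).

Definition comp_step (p : role * nat) (l : option event) : role * nat :=
  let (t', sh) := read_letter p.1 (read x p.2) l in (t', shifted N sh p.2).

Lemma cell_pos_eq0 w j : w < N -> j < N -> (cell_pos w j == 0) = (w == j).
Proof.
move=> wN jN; rewrite /cell_pos; case: (ltnP w j) => wj.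
  by rewrite modn_small; [apply/eqP/eqP | ]; lia.
have -> : w + (N - j) = (w - j) + N by lia.
rewrite modnDr modn_small; last by lia.
by apply/eqP/eqP; lia.
Qed.

(** A cell sees only its offset from the head; the flag in the rule tells it whether a move left is
    blocked at cell 0. *)
Lemma cell_pos_work_shift mw w j : 
  let w' := match mw with MLeft => w.-1 | MStay => w | MRight => w.+1 end in
  cell_pos w' j = shifted N (work_shift mw (w == 0)) (cell_pos w j).
Proof.
rewrite /cell_pos; case: mw => //=; last by rewrite addSn -addn1 -[in RHS]addn1 modnDml.
case: w => //= w; rewrite modnDml.
have -> : w.+1 + (N - j) + N.-1 = w + (N - j) + N by lia.
by rewrite modnDr.
Qed.

Lemma work_shift_pos mw w :
  let w' := match mw with MLeft => w.-1 | MStay => w | MRight => w.+1 end in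
  w < N -> w' < N -> shifted N (work_shift mw (w == 0)) w = w'.
Proof.
case: mw => //= wN w'N; last by rewrite modn_small.
case: w wN w'N => //= w wN _.
have -> : w.+1 + N.-1 = w + N by lia.
by rewrite modnDr modn_small //; lia.
Qed.

Lemma input_shift_pos mi i : i <= (size x).+1 ->
  shifted N (input_shift mi (read x i)) i = imove x mi i.
Proof.
move=> ix; case: mi => //=.
  rewrite read_LEnd; case: i ix => //= i ix.
  have -> : i.+1 + N.-1 = i + N by lia.
  by rewrite modnDr modn_small //; lia.
rewrite read_REnd; case: ltnP => /= xi; last by rewrite modn_small; lia.
by lia.
Qed.

(** The bounds on both head positions keep arithmetic modulo [N] exact for [Main] and [Head]. *)
Lemma comp_step_event t k : ~~ halted (cf t) -> valid k ->
  comp_step (comp_state t k) (Some (event_at t)) = comp_state t.+1 k.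
Proof.
move=> nh vk; have wt := wposN t; have wt1 : wpos (step x (cf t)) < N := wposN t.+1.
have it := ipos_conf M x t.
have nhq : (st (cf t) != qacc M) && (st (cf t) != qrej M) by rewrite -negb_or.
(* A trivial equation, unfolded on its right side only, becomes the rewriting rule for the next
   configuration. *)
have E : step x (cf t) = step x (cf t) by [].
rewrite {2}/step (negbTE nh) in E.
rewrite /comp_step /event_at /read_letter.
case Ed : (delta _ _ _ _) E => [[[[q' g'] mi] mw] o] E.
case: k vk => [[j|]|] /= vk; rewrite E in wt1 *.
- rewrite read_LEnd cell_pos_eq0 //; case: eqP => [wj|/eqP/negbTE wj] /=.
    by rewrite wj !eqxx -cell_pos_work_shift.
  by rewrite [j == _]eq_sym wj -cell_pos_work_shift.
- by rewrite read_LEnd eqxx work_shift_pos.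
case/andP: nhq => -> ->; rewrite !eqxx /=.
by rewrite input_shift_pos.
Qed.

(** [Main] objects to a halted configuration, a wrong state or a wrong input symbol, [Head] to a
    wrong flag, and the scanned cell to a wrong work symbol. Together they check every field of the
    rule. *)
Lemma comp_step_mismatch t e : ~~ rejecting (st (cf t)) ->
  (halted (cf t) \/ e <> event_at t) ->
  exists2 k, valid k & (comp_step (comp_state t k) (Some e)).1 = Sink.
Proof.
move=> nr bad; case: e bad => [[[q a] g] z] bad.
have nhalt : [&& st (cf t) != qacc M, st (cf t) != qrej M, st (cf t) == q
    & read x (ipos (cf t)) == a] -> ~~ halted (cf t).
  by case/and4P => na nr' _ _; rewrite negb_or na.
rewrite /comp_step /read_letter.
case Ed : (delta _ _ _ _) => [[[[q' g'] mi] mw] o].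
case main : [&& st (cf t) != qacc M, st (cf t) != qrej M, st (cf t) == q
    & read x (ipos (cf t)) == a]; last by exists None => //=; rewrite main.
case head : (z == (wpos (cf t) == 0)); last by exists (Some None); rewrite //= read_LEnd head.
have nh := nhalt main; case: bad => [h|bad]; first by rewrite h in nh.
exists (Some (Some (wpos (cf t)))) => //=.
rewrite read_LEnd cell_pos_eq0 // eqxx; case: eqP => //= eg; case: bad.
by case/and4P: main => _ _ /eqP <- /eqP <-; rewrite /event_at eg (eqP head).
Qed.

Lemma run_cat p u w : run p (u ++ w) = run (run p u) w.
Proof. exact: foldl_cat. Qed.

Lemma run_Sink c r w : final (Some (run ((Sink, c), r) w).1).
Proof.
elim: w c r => //= b w IH c r; rewrite /rstep /=.
case: b; first by case: insub => [c'|] /=; apply: IH.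
by case: (odecode c) => [[[[q a] g] z]|] /=; [case: delta => [[[[? ?] ?] ?] ?] | ]; apply: IH.
Qed.

Definition start_state (p : role * nat) (c : progress) : bstate * nat := ((p.1, c), p.2).

Lemma rstep_letter p c :
  rstep (start_state p c) false = start_state (comp_step p (odecode c)) ord0.
Proof. by rewrite /rstep /comp_step /=; case: read_letter. Qed.

(** Induction on the word, with [t] the number of rules verified so far and [c] the progress in the
    current letter, common to all components. At the first error some component enters [Sink];
    without errors [Main] accepts at the end. *)
Lemma accept_all : (forall t, ~~ rejecting (st (cf t))) -> forall w t c,
  exists2 k, valid k & final (Some (run (start_state (comp_state t k) c) w).1).
Proof.
move=> nr; elim=> [|b w IH] t c.
  by exists None => //=; rewrite (negbTE (nr t)).
case: b.
  case Ec : (insub c.+1 : option progress) => [c'|].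
    have [k vk fk] := IH t c'; exists k => //=.
    by rewrite /rstep /= Ec.
  by exists None => //=; rewrite /rstep /= Ec; apply: run_Sink.
rewrite -/(run _ _); have sinks k p : (comp_step (comp_state t k) (odecode c)) = p -> p.1 = Sink ->
    final (Some (run (start_state (comp_state t k) c) (false :: w)).1).
  move=> E p1; rewrite /= rstep_letter E /start_state p1; exact: run_Sink.
case El : (odecode c) sinks => [e|] sinks; last first.
  by exists None => //; apply: sinks (erefl _) _; rewrite /comp_step /= (negbTE (nr t)).
have [h|/negP nh] := boolP (halted (cf t)).
  have [k vk Ek] := comp_step_mismatch (nr t) (or_introl h : _ \/ e <> event_at t).
  by exists k => //; apply: sinks (erefl _) Ek.
have [Ee|ne] := eqVneq e (event_at t); last first.
  have [k vk Ek] := comp_step_mismatch (nr t) (or_intror (elimN eqP ne) : halted (cf t) \/ _).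
  by exists k => //; apply: sinks (erefl _) Ek.
have [k vk fk] := IH t.+1 ord0; exists k => //=.
by rewrite rstep_letter El Ee comp_step_event //; apply/negP.
Qed.

Definition letter_word (l : option event) : seq bool := enc_nat (ocode l).

Lemma run_ones t r (c c' : progress) n : c + n = c' ->
  run ((t, c), r) (nseq n true) = ((t, c'), r).
Proof.
elim: n c => [|n IH] c /= E; first by congr (_, _, _); apply: val_inj; rewrite /= -E addn0.
have c1 : c.+1 < #|{: event}|.+1 by have := ltn_ord c'; lia.
by rewrite [rstep _ true]/rstep /= insubT /= (IH (Ordinal c1)) //= -E; lia.
Qed.

Lemma run_letter p l :
  run (start_state p ord0) (letter_word l) = start_state (comp_step p l) ord0.
Proof.
rewrite /letter_word /enc_nat run_cat.
by rewrite [start_state p _]/start_state (@run_ones _ _ ord0 (ocode l)) // [LHS]rstep_letter ocodeK.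
Qed.

Definition history (t : nat) : seq bool :=
  flatten [seq letter_word (Some (event_at i)) | i <- iota 0 t].

Lemma historyS t : history t.+1 = history t ++ letter_word (Some (event_at t)).
Proof. by rewrite /history -[t.+1]addn1 iotaD map_cat flatten_cat /= cats0. Qed.

Lemma run_history t k : (forall i, i < t -> ~~ halted (cf i)) -> valid k ->
  run (start_state (comp_state 0 k) ord0) (history t) = start_state (comp_state t k) ord0.
Proof.
move=> nh vk; elim: t nh => // t IH nh.
rewrite historyS run_cat IH; last by move=> i it; apply: nh; lia.
by rewrite run_letter comp_step_event // nh.
Qed.

(** No component objects to a genuine history, and of the extra letters that follow only [Main]
    keeps track, by their parity. *)
Lemma reject_history t n : (forall i, i < t -> ~~ halted (cf i)) -> rejecting (st (cf t)) ->
  forall k, valid k ->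
  final (Some (run (start_state (comp_state 0 k) ord0) (history t ++ nseq n false)).1) =
  if k is None then odd n else false.
Proof.
move=> nh rj k vk; rewrite run_cat run_history //.
(* A bit 0 at a letter boundary is the extra letter. *)
have odeco0 : odecode (ord0 : progress) = None by rewrite -(ocodeK (None : option event)).
have pad tg r : (forall a, read_letter tg a None = (tg, Same)) ->
    run ((tg, ord0), r) (nseq n false) = ((tg, ord0), r).
  by move=> ts; elim: (n) => //= m IH; rewrite [rstep _ false]/rstep /= odeco0 ts.
case: k vk => [[j|]|] vk; rewrite /start_state /=; [by rewrite pad | by rewrite pad | ].
have -> par : run ((Main (st (cf t)) par, ord0), ipos (cf t)) (nseq n false) =
    ((Main (st (cf t)) (par (+) odd n), ord0), ipos (cf t)).
  elim: (n) par => [|m IH] par /=; first by rewrite addbF.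
  by rewrite [in LHS]/rstep /= odeco0 /= rj [LHS]IH addbN addNb.
by rewrite /= rj eqxx andbT negbK.
Qed.

Lemma comp_state0 k : comp_state 0 k =
  match k with
  | None => (Main (q0 M) false, 0) | Some None => (Head, 0)
  | Some (Some j) => (Cell ord0, (N - j) %% N)
  end.
Proof. by case: k => [[j|]|]. Qed.

Lemma acc_components b w : acc_from red_nfa (init red_nfa) (map nat_of_bool (b :: w)) <->
  exists2 k, valid k & final (Some (run (start_state (comp_state 0 k) ord0) w).1).
Proof.
rewrite acc_init; split=> [[H|H|[r rN H]]|[k vk]].
- by exists None.
- by exists (Some None).
(* The work head starts at 0, so the number [r] belongs to the cell [-r] modulo [N]. *)
- have rE : (N - (N - r) %% N) %% N = r.
    case: r rN {H} => [|r] rN; first by rewrite subn0 modnn subn0 modnn.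
    by rewrite (modn_small (_ : N - r.+1 < N)) ?subKn ?modn_small //; lia.
  exists (Some (Some ((N - r) %% N))); first by rewrite /= ltn_mod.
  by rewrite comp_state0 /start_state /= rE.
rewrite comp_state0; case: k vk => [[j|]|] vk H;
  [constructor 3 | by constructor 2 | by constructor 1].
by exists ((N - j) %% N); rewrite ?ltn_mod.
Qed.
End Simulation.
End Reduction.
End Automaton.

(** * Encoding of the reduction *)

Section Encoding.
Variable M : TM.
Notation bstate := (role M * 'I_#|{: 'I_(nq M).+1 * insym * 'I_(ng M).+1 * bool}|.+1)%type.
Notation nstate := (option bstate).
Notation K := #|{: nstate}|.

Definition literal (s : seq bool) : piece := Piece Zero [::] s.
(** The condition selects [r = 0], hence a single copy. *)
Definition once (s : seq bool) : item :=
  Item (pred1 LEnd) (fun k => literal (if k then [::] else s)).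
Definition each (c : insym -> bool) (s : seq bool) : item :=
  Item c (fun k => literal (if k then [::] else s)).
Definition num_piece (s : nstate) (sh : shift) (t : seq bool) : piece :=
  Piece sh (nseq K true) (enc_nat (enum_rank s) ++ t).

(** Follows [enc_nfa] field by field; the third entry joins the closing bit of the number of states
    to the initial state. A list length is printed by an extra pass over the list with one bit per
    entry. *)
Definition red_items : seq item :=
  [:: once (enc_nat 2)] ++ [:: each predT (nseq K true)] ++
  [:: once (false :: enc_nat (enum_rank (None : nstate)))] ++
  [seq each (scond s) [:: true] | s <- schemas M] ++ [:: once [:: false]] ++
  [seq Item (scond s) (fun k => if k then num_piece (stgt s) (tshift s) [::]
                                else num_piece (ssrc s) (sshift s) (enc_nat (sbit s)))
  | s <- schemas M] ++
  [seq each predT [:: true] | s <- finals M] ++ [:: once [:: false]] ++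
  [seq Item predT (fun k => if k then literal [::] else num_piece s Same [::])
  | s <- finals M].

Variables (x : seq bool) (N : nat).
Hypothesis N0 : 0 < N.

Lemma piece_literal r s : piece_out N r (literal s) = s.
Proof. by []. Qed.

Lemma flatten_nseq_nseq T (a : T) k n : flatten (nseq n (nseq k a)) = nseq (n * k) a.
Proof. by elim: n => //= n ->; rewrite mulSn nseqD. Qed.

Lemma piece_num s sh t r :
  piece_out N r (num_piece s sh t) = enc_nat (num s (shifted N sh r)) ++ t.
Proof.
by rewrite /piece_out /= flatten_nseq_nseq /num /enc_nat nseqD -!catA.
Qed.

Lemma item_once s : item_out N x (once s) = s.
Proof.
rewrite /item_out -(prednK N0) /= !cats0.
rewrite (_ : flatten _ = [::]) ?cats0 //.
have : all (fun r => 0 < r) (iota 1 N.-1) by apply/allP => r; rewrite mem_iota => /andP[].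
by elim: (iota _ _) => //= r rs IH /andP[r0 /IH ->]; rewrite read_LEnd eqn0Ngt r0.
Qed.

Lemma items_out_cat its1 its2 :
  items_out N x (its1 ++ its2) = items_out N x its1 ++ items_out N x its2.
Proof. by rewrite /items_out map_cat flatten_cat. Qed.

Lemma nseq_flatten T (A : Type) (f : T -> seq A) (F : T -> seq bool) s :
  (forall t, F t = nseq (size (f t)) true) ->
  flatten [seq F t | t <- s] = nseq (size (flatten [seq f t | t <- s])) true.
Proof. by move=> E; elim: s => //= t s ->; rewrite size_cat nseqD E. Qed.

Lemma items_out_map T (f : T -> item) s :
  items_out N x (map f s) = flatten [seq item_out N x (f t) | t <- s].
Proof. by rewrite /items_out -map_comp. Qed.

Lemma items_out_once s : items_out N x [:: once s] = s.
Proof. by rewrite /items_out /= item_once cats0. Qed.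

Lemma enc_nst : enc_nat (N * K) = items_out N x [:: each predT (nseq K true)] ++ [:: false].
Proof.
rewrite /enc_nat -flatten_nseq_nseq /items_out /= cats0; congr (_ ++ _).
rewrite -[in LHS](size_iota 0 N) /item_out.
by elim: (iota _ _) => //= r rs ->; rewrite piece_literal cats0.
Qed.

Lemma enc_size_trans : enc_nat (size (redtrans M x N)) =
  items_out N x [seq each (scond s) [:: true] | s <- schemas M] ++ [:: false].
Proof.
rewrite /enc_nat items_out_map; congr (_ ++ _); apply/esym/nseq_flatten => s.
by apply: nseq_flatten => r /=; case: ifP.
Qed.

Lemma enc_trans : flatten [seq enc_nat t.1.1 ++ enc_nat t.1.2 ++ enc_nat t.2
                          | t <- redtrans M x N] =
  items_out N x [seq Item (scond s) (fun k => if k then num_piece (stgt s) (tshift s) [::]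
                       else num_piece (ssrc s) (sshift s) (enc_nat (sbit s))) | s <- schemas M].
Proof.
rewrite items_out_map /redtrans; elim: (schemas M) => //= s ss <-.
rewrite map_cat flatten_cat; congr (_ ++ _); rewrite /item_out.
elim: (iota 0 N) => //= r rs <-; rewrite map_cat flatten_cat; congr (_ ++ _).
by case: ifP => //= _; rewrite !piece_num !cats0 -!catA.
Qed.

Lemma enc_size_fin : enc_nat (size (fin (red_nfa M x N))) =
  items_out N x [seq each predT [:: true] | s <- finals M] ++ [:: false].
Proof.
rewrite /enc_nat items_out_map; congr (_ ++ _); apply/esym/nseq_flatten => s.
rewrite -(flatten_seq1 [seq _ | r <- _]) -map_comp.
exact: nseq_flatten.
Qed.

Lemma enc_fin : flatten [seq enc_nat q | q <- fin (red_nfa M x N)] =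
  items_out N x [seq Item predT (fun k => if k then literal [::] else num_piece s Same [::])
                | s <- finals M].
Proof.
rewrite items_out_map /=; elim: (finals M) => //= s ss <-.
rewrite map_cat flatten_cat -map_comp; congr (_ ++ _); congr flatten.
by apply: eq_map => r /=; rewrite piece_num /= !cats0.
Qed.

Lemma enc_red_nfa : enc_nfa (red_nfa M x N) = items_out N x red_items.
Proof.
rewrite /red_items !items_out_cat -enc_trans -enc_fin !items_out_once.
rewrite /enc_nfa enc_size_fin -[size (trans _)]/(size (redtrans M x N)) enc_size_trans.
by rewrite -[nst _]/(N * K) enc_nst -!catA.
Qed.

Lemma num_lt (s : nstate) r : r < N -> num s r < N * K.
Proof.
move=> rN; apply: (@leq_trans (r.+1 * K)); last by rewrite leq_mul2r rN orbT.
by rewrite /num mulSn [K + _]addnC ltn_add2l ltn_ord.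
Qed.

Lemma red_nfa_wf : nfa_wf (red_nfa M x N).
Proof.
apply/and3P; split.
- exact: (@num_lt None 0).
- apply/allP => tr /redtransP [s [r [_ rN _ ->]]] /=.
  by rewrite !num_lt ?shifted_lt // /strans /=; case: sbit.
apply/allP => q /flatten_mapP [s _ /mapP [r]]; rewrite mem_iota => /andP[_ rN] ->.
exact: num_lt.
Qed.
End Encoding.

(** * Unique decoding of automata *)

Lemma enc_nat_inj n n' s s' : enc_nat n ++ s = enc_nat n' ++ s' -> n = n' /\ s = s'.
Proof.
elim: n n' => [|n IH] [|n'] //=; first by case.
by case=> /IH [-> ->].
Qed.

Lemma enc_list_inj T (f : T -> seq bool) (l l' : seq T) s s' :
  (forall t t' u u', f t ++ u = f t' ++ u' -> t = t' /\ u = u') ->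
  size l = size l' ->
  flatten [seq f t | t <- l] ++ s = flatten [seq f t | t <- l'] ++ s' -> l = l' /\ s = s'.
Proof.
move=> fI; elim: l l' => [|t l IH] [|t' l'] //= [sz]; rewrite -!catA.
by case/fI => -> /IH [] // -> ->.
Qed.

(** The membership problem speaks of some automaton with the given encoding; injectivity identifies
    it with the constructed one. *)
Lemma enc_nfa_inj : injective enc_nfa.
Proof.
move=> [k n i t f] [k' n' i' t' f']; rewrite /enc_nfa /=.
move=> /enc_nat_inj [-> /enc_nat_inj [-> /enc_nat_inj [-> /enc_nat_inj [szt]]]].
case/enc_list_inj=> // [[[p a] q] [[p' a'] q'] u u'|-> /enc_nat_inj [szf]].
  rewrite /= -!(catA (enc_nat p)) -!(catA (enc_nat a)) -!(catA (enc_nat p')).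
  by rewrite -!(catA (enc_nat a')) => /enc_nat_inj [-> /enc_nat_inj [-> /enc_nat_inj [-> ->]]].
rewrite -[flatten _]cats0 -[flatten [seq _ | q <- f']]cats0.
by case/enc_list_inj=> // [q q' u u' /enc_nat_inj|->].
Qed.

(** * The language of the constructed automaton *)

Section Language.
Variables (M : TM) (x : seq bool) (N : nat).
Hypothesis wposN : forall t, wpos (conf M x t) < N.
Hypothesis sizeN : (size x).+1 < N.

Let N0 : 0 < N. Proof. exact: leq_ltn_trans sizeN. Qed.

Notation A := (red_nfa M x N).

Lemma nfa_lang_map (w : seq 'I_2) : nfa_lang A w <->
  acc_from A (init A) (map nat_of_bool [seq nat_of_ord i == 1 | i <- w]).
Proof.
rewrite /nfa_lang -map_comp.
have -> // : map (@nat_of_ord _) w = map (nat_of_bool \o (fun i : 'I_2 => (i : nat) == 1)) w.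
by apply: eq_map => -[[|[|m]] i].
Qed.

Lemma red_nfa_full : (forall t, ~~ rejecting (st (conf M x t))) -> forall w, nfa_lang A w.
Proof.
move=> nr w; apply/nfa_lang_map; case: w => [|b w].
  (* The empty word has no bit to skip; it is accepted because the initial state is final. *)
  exact: etrans (@mem_final M x N None 0 N0) _.
rewrite map_cons; apply/acc_components => //.
exact: (@accept_all M x N N0 wposN sizeN nr _ 0 ord0).
Qed.

Lemma red_nfa_not_aperiodic t : halted (conf M x t) -> st (conf M x t) <> qacc M ->
  ~ aperiodic (nfa_lang A).
Proof.
move=> ht na.
(* The first halting time is taken so that the history lists only actual steps. *)
have [t0 ht0 t0min] := ex_minnP (ex_intro (fun t => halted (conf M x t)) t ht).
have Et : conf M x t = conf M x t0 by apply: conf_halted => //; apply: t0min.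
have rj : rejecting (st (conf M x t0)).
  rewrite -Et /rejecting (introF eqP na) andbT.
  by move: ht; rewrite /halted (introF eqP na).
have nh i : i < t0 -> ~~ halted (conf M x i).
  by move=> it; apply/negP => /t0min; rewrite leqNgt it.
(* The leading 0 is the skipped bit; repeating the letter 0 after the history then makes acceptance
   depend on parity. *)
pose u : seq 'I_2 := ord0 :: map (fun b : bool => inord b) (history M x t0).
have acc n : nfa_lang A (u ++ pow [:: ord0] n ++ [::]) <-> odd n.
  rewrite nfa_lang_map /u cat_cons map_cons cats0 map_cat -map_comp.
  rewrite (_ : map _ (history M x t0) = history M x t0); last first.
    by rewrite -[RHS]map_id; apply: eq_map => -[] /=; rewrite inordK.
  rewrite (_ : map _ (pow _ n) = nseq n false); last by elim: n => //= n ->.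
  rewrite acc_components //; split=> [[k vk]|on].
    by rewrite (reject_history N0 wposN sizeN) //; case: k vk.
  by exists None => //; rewrite (reject_history N0 wposN sizeN).
case=> m aN; have := aN m u [:: ord0] [::] (leqnn m); rewrite !acc /=.
by case: odd => -[] //; auto.
Qed.
End Language.

(** With [y = 2 ^ width n], which exceeds [n + 2], the right side is [y * (y ^ c * y ^ c)]. Both
    [c * n ^ c] and [c] are at most [y ^ c * y ^ c], and the factor [y] covers their sum. *)
Lemma poly_bound c n : c * n ^ c + c <= (2 ^ (2 * c).+1) ^ width n /\
  n.+1 < (2 ^ (2 * c).+1) ^ width n.
Proof.
have lt : n.+2 < 2 ^ width n by apply: trunc_log_ltn.
rewrite -expnM [_.+1 * _]mulnC expnM; move: (2 ^ width n) lt => y lt.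
rewrite expnS mul2n -addnn expnD.
have nc : n ^ c <= y ^ c by case: c => // c; rewrite leq_exp2r //; lia.
have cy : c < y ^ c by apply: ltn_expl; lia.
have cX : c * n ^ c <= y ^ c * y ^ c by apply: leq_mul => //; apply: ltnW.
have c1 : c < y ^ c * y ^ c by apply: (leq_trans cy); rewrite leq_pmulr // (leq_ltn_trans _ cy).
have y3 : n.+3 * (y ^ c * y ^ c) <= y * (y ^ c * y ^ c) by rewrite leq_mul2r lt orbT.
move: (y ^ c * y ^ c) (c * n ^ c) cX c1 y3 => z t cX c1 y3.
have n3 : n.+3 <= n.+3 * z by rewrite leq_pmulr // (leq_ltn_trans _ c1).
by rewrite !mulSn in n3 y3; split; lia.
Qed.

Theorem theorem1 (h : hierarchy) (n : nat) (half : bool) :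
  PSPACE_hard (NFA_membership (level h n half)) /\
  PSPACE_hard (NFA_membership_bin (level h n half)).
Proof.
have key P : PSPACE P -> exists2 f, logspace_computable f &
    forall x, exists A, [/\ nfa_wf A, alph A = 2, enc_nfa A = f x
                       & P x <-> level h n half (alph A) (nfa_lang A)].
  case=> M [c Mc].
  (* The exponent [c] of the space bound goes into the base, so that counters of logarithmic width
     reach the polynomial bound. *)
  pose B' := (2 ^ (2 * c).+1).-1.
  have B'S : B'.+1 = 2 ^ (2 * c).+1 by rewrite prednK ?expn_gt0.
  have B'0 : 0 < B' by rewrite -ltnS B'S expnS; have := expn_gt0 2 (2 * c); lia.
  exists (fun x => items_out (B'.+1 ^ width (size x)) x (red_items M)).
    exact: logspace_items.
  move=> x; set N := _ ^ _.
  have [cN xN] : c * size x ^ c + c <= N /\ (size x).+1 < N.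
    by rewrite /N B'S; apply: poly_bound.
  have [wb [t [ht Pt]]] := Mc x.
  have wposN t' : wpos (conf M x t') < N := leq_trans (wb t') cN.
  have N0 : 0 < N by apply: leq_ltn_trans xN.
  exists (red_nfa M x N); split=> //; first exact: red_nfa_wf.
    exact: enc_red_nfa.
  split=> [Px|lev].
    apply: level_full => w; apply: red_nfa_full => // t'; apply/negP => /andP[rj na].
    have ht' : halted (conf M x t') by rewrite /halted rj orbT.
    (* All halted configurations of one run agree, so an accepting run never shows a rejecting
       state. *)
    have E : conf M x t = conf M x t'.
      by case: (leqP t t') => tt'; rewrite ?(conf_halted ht tt') ?(conf_halted ht' (ltnW tt')).
    by move: na; rewrite -E; case/eqP; apply/Pt.
  apply/Pt; case: (st (conf M x t) =P qacc M) => // na.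
  by case: (red_nfa_not_aperiodic wposN xN ht na); apply: aperiodic_level lev.
split=> P /key [f fl Hf]; exists f; split=> // x; have [A [wf A2 E PA]] := Hf x.
  rewrite PA; split=> [lev|[A' [_ [E' lev]]]]; first by exists A.
  by have <- : A' = A by apply: enc_nfa_inj; rewrite E' E.
rewrite PA; split=> [lev|[A' [_ [_ [E' lev]]]]]; first by exists A.
by have <- : A' = A by apply: enc_nfa_inj; rewrite E' E.
Qed.
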